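(* Let $(\Omega,\Sigma,\mu)$ be a finite measure space, let $E$ be a separable Banach space, let $1\le p<\infty$ with conjugate exponent $q$ ($1/p+1/q=1$), and let $M:\Omega\rightrightarrows E$ be a closed-valued multifunction with $\mathrm{gph}\,M\in\Sigma\otimes\mathcal{B}(E)$. Define $\mathcal{M}=\{f\in L^p(\mu,E): f(\omega)\in M(\omega)\ \text{a.e. }\omega\in\Omega\}$. If $\bar{f}\in\mathcal{M}$ and $M(\omega)$ is regular at $\bar{f}(\omega)$ for a.e. $\omega\in\Omega$, then $$N^\circ(\bar{f};\mathcal{M})=\{g\in L^q_{w^*}(\mu,E^* ): g(\omega)\in N^\circ(\bar{f}(\omega);M(\omega))\ \text{a.e. }\omega\in\Omega\}.$$
   Context: $\mathcal{B}(E)$ is the Borel $\sigma$-algebra of the norm topology. $L^p(\mu,E)$ is the space of ($\mu$-equivalence classes of) Bochner integrable $E$-valued maps with $\int\|f\|^p\,d\mu<\infty$. $L^q_{w^*}(\mu,E^* )$ is the space of ($\mu$-equivalence classes of) maps $g:\Omega\to E^*$ that are weak$^*$-scalarly measurable (i.e. $\omega\mapsto\langle g(\omega),x\rangle$ is measurable for each $x\in E$) with $\|g(\cdot)\|\in L^q(\mu)$; for separable $E$ it is identified with the dual of $L^p(\mu,E)$ via $\langle g,f\rangle=\int\langle g(\omega),f(\omega)\rangle\,d\mu$. For a subset $C$ of a Banach space $X$ and $\bar{x}\in C$: $d_C(x)=\inf_{c\in C}\|c-x\|$; the Clarke directional derivative of a locally Lipschitz $\phi$ is $\phi^\circ(\bar{x};h)=\limsup_{x\to\bar{x},\theta\downarrow0}(\phi(x+\theta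 h)-\phi(x))/\theta$ and $\partial^\circ\phi(\bar{x})=\{x^*:\langle x^*,h\rangle\le\phi^\circ(\bar{x};h)\ \forall h\}$; the Clarke normal cone is $N^\circ(\bar{x};C)=$ weak$^*$ closure of $\bigcup_{\alpha>0}\alpha\,\partial^\circ d_C(\bar{x})$; the Clarke tangent cone is $T^\circ(\bar{x};C)=\{h:\langle x^*,h\rangle\le0\ \forall x^*\in N^\circ(\bar{x};C)\}$; the contingent cone is $K(\bar{x};C)=\{h:\liminf_{\theta\downarrow0}d_C(\bar{x}+\theta h)/\theta=0\}$; $C$ is regular at $\bar{x}$ if $T^\circ(\bar{x};C)=K(\bar{x};C)$. *)

(* Defs.v *)
From mathcomp Require Import all_boot all_order all_algebra.
From mathcomp Require Import all_classical all_reals all_analysis.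
Set Implicit Arguments. Unset Strict Implicit. Unset Printing Implicit Defensive.
Import Order.TTheory GRing.Theory Num.Theory.
Local Open Scope classical_set_scope.
Local Open Scope ring_scope.

(* Generic nonsmooth-analysis notions in a (semi)normed space given as *)
(* a subset [Xs] of an R-vector space [V] (closed under the vector     *)
(* operations) with a norm [nm].  Dual elements (elements of X^* ) are *)
(* represented by functions [V -> R] that are linear and bounded on Xs.*)
Section Clarke.
Variables (R : realType) (V : lmodType R) (Xs : set V) (nm : V -> R).

Definition dual_elt (l : V -> R) : Prop :=
  (forall (a : R) (x y : V), Xs x -> Xs y -> l (a *: x + y) = a * l x + l y) /\
  (exists K : R, forall x, Xs x -> `|l x| <= K * nm x).

Definition distC (C : set V) (x : V) : R := inf [set nm (c - x) | c in C].

(* Clarke directional derivative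
   phi°(xb; h) = limsup_{x -> xb, theta ↓ 0} (phi(x + theta h) - phi(x)) / theta
   = inf_{delta > 0} sup { ... | x in X, ||x - xb|| < delta, 0 < theta < delta } *)
Definition clarke_dd (phi : V -> R) (xb h : V) : \bar R :=
  ereal_inf [set ereal_sup [set r | exists x th, Xs x /\ nm (x - xb) < del /\
                 0 < th /\ th < del /\ r = ((phi (x + th *: h) - phi x) / th)%:E]
            | del in [set del : R | 0 < del]].

Definition clarke_subdiff (phi : V -> R) (xb : V) : set (V -> R) :=
  [set l | dual_elt l /\ forall h, Xs h -> ((l h)%:E <= clarke_dd phi xb h)%E].

Definition wstar_closure (S : set (V -> R)) : set (V -> R) :=
  [set l | dual_elt l /\
     forall (F : set V) (e : R), finite_set F -> F `<=` Xs -> 0 < e ->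
       exists s, S s /\ forall h, F h -> `|s h - l h| < e].

Definition clarke_normal (C : set V) (xb : V) : set (V -> R) :=
  wstar_closure [set l | exists (a : R) (l0 : V -> R),
     0 < a /\ clarke_subdiff (distC C) xb l0 /\ l = (fun x => a * l0 x)].

Definition clarke_tangent (C : set V) (xb : V) : set V :=
  [set h | Xs h /\ forall l, clarke_normal C xb l -> l h <= 0].

(* contingent cone: liminf_{theta ↓ 0} d_C(xb + theta h)/theta = 0 *)
Definition contingent (C : set V) (xb : V) : set V :=
  [set h | Xs h /\
     ereal_sup [set ereal_inf [set r | exists th, 0 < th /\ th < del /\
                   r = (distC C (xb + th *: h) / th)%:E]
               | del in [set del : R | 0 < del]] = 0%E].

Definition regular_at (C : set V) (xb : V) : Prop :=
  clarke_tangent C xb = contingent C xb.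

End Clarke.

Section Lp.
Variables (R : realType) (d : measure_display) (T : measurableType d)
  (mu : {measure set T -> \bar R}) (E : normedModType R).

(* Borel measurability w.r.t. the norm topology of E (for separable E this
   is Bochner/strong measurability, by Pettis' theorem) *)
Definition borel_meas (f : T -> E) : Prop :=
  forall U : set E, open U -> measurable (f @^-1` U).

Definition Lp (p : R) (f : T -> E) : Prop :=
  borel_meas f /\ (\int[mu]_w ((`|f w|) `^ p)%:E < +oo)%E.

Definition Lpnorm (p : R) (f : T -> E) : R :=
  (fine (\int[mu]_w ((`|f w|) `^ p)%:E)) `^ p^-1.

Definition dual_norm (l : E -> R) : \bar R :=
  ereal_sup [set (`|l x|)%:E | x in [set x : E | `|x| <= 1]].

Definition Lq_wstar (p : R) (g : T -> E -> R) : Prop :=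
  (forall w, dual_elt [set: E] (@Num.Def.normr _ E) (g w)) /\
  (forall x : E, measurable_fun [set: T] (fun w => g w x)) /\
  measurable_fun [set: T] (fun w => fine (dual_norm (g w))) /\
  (if p == 1 then exists c : R, {ae mu, forall w, (dual_norm (g w) <= c%:E)%E}
   else (\int[mu]_w ((fine (dual_norm (g w))) `^ (p / (p - 1)))%:E < +oo)%E).

Definition pairing (g : T -> E -> R) : (T -> E) -> R :=
  fun f => Rintegral mu [set: T] (fun w => g w (f w)).

Definition Lp_selections (p : R) (M : T -> set E) : set (T -> E) :=
  [set f | Lp p f /\ {ae mu, forall w, M w (f w)}].

End Lp.

Definition gph_measurable (R : realType) (d : measure_display)
  (T : measurableType d) (E : normedModType R) (M : T -> set E) : Prop :=
  <<s [set AB | exists (A : set T) (B : set E),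
          measurable A /\ <<s open >> B /\ AB = A `*` B] >>
    [set wx | M wx.1 wx.2].

(* Main.v *)
Require Import Defs.
From mathcomp Require Import all_boot all_order all_algebra.
From mathcomp Require Import all_classical all_reals all_analysis.
From mathcomp Require Import measurable_realfun ring lra.
Set Implicit Arguments. Unset Strict Implicit. Unset Printing Implicit Defensive.
Import Order.TTheory GRing.Theory Num.Theory.
Local Open Scope classical_set_scope.
Local Open Scope ring_scope.

(** Tangent cones are compared first, then polarized. In a seminormed space
    Hahn-Banach gives T(x; C) = { h | d_C°(x; h) <= 0 }, and makes N(x; C) the
    polar of T(x; C), because weak-star neighbourhoods test finitely many vectors.
    For the set of selections, T(fb) consists of the h in L^p with h(w) in
    T(fb(w); M(w)) a.e.: one inclusion extracts an a.e. convergent subsequence,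
    and then regularity turns the contingent direction h(w) into a tangent one;
    the other is dominated convergence, since d(z)^p <= int d_M(w)(z(w))^p for
    the set of selections. Polarizing, g(w) in N(w) a.e. gives <g, h> <= 0 by
    integration. Conversely, if g(w) were positive somewhere on T(w) for
    non-negligibly many w, a measurable selection of such directions would be a
    tangent direction on which g is positive. Measurable selections come from
    Aumann's theorem: product-measurable sets are Souslin, and measurable hulls
    of the projections of the nodes of a Souslin scheme yield a branch a.e. *)

(** * Hahn-Banach *)

(** Elements of [Lp] are functions rather than classes, so [Lpnorm] is only a seminorm on a
    subspace. The convex analysis is therefore done once for a seminormed subspace [Xs], and applied
    both to [Lp] and to [E]. Regularity enters twice. From tangency in [Lp] only the information at
    the base point [fb] is carried over to points, and this yields contingent directions. Moreover
    the Clarke tangent cone quantifies over all points of [M w] near [fb w], whereas the contingent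
    cone is described at [fb w] by countably many conditions with rational steps, so that its graph
    is measurable and selections can be taken from it. The measure space need not be complete:
    projections of measurable sets may fail to be measurable. Hence selections exist only up to a
    null set, and the distance to [M w] is replaced by the distance to a countable family of
    selections, dense almost everywhere. *)

Section HahnBanach.
Variables (R : realType) (V : lmodType R) (X : set V).
Hypotheses (X0 : X 0) (XL : forall (a : R) x y, X x -> X y -> X (a *: x + y)).

Definition sublinear (q : V -> R) :=
  (forall x y, X x -> X y -> q (x + y) <= q x + q y) /\
  (forall a x, 0 < a -> X x -> q (a *: x) = a * q x).

Lemma subspD x y : X x -> X y -> X (x + y).
Proof. by move=> Xx Xy; rewrite -(scale1r x); exact: XL. Qed.

Lemma subspZ (a : R) x : X x -> X (a *: x).
Proof. by move=> Xx; rewrite -[_ *: _]addr0; exact: XL. Qed.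

Lemma subspN x : X x -> X (- x).
Proof. by move=> Xx; rewrite -scaleN1r; exact: subspZ. Qed.

Lemma subspB x y : X x -> X y -> X (x - y).
Proof. by move=> Xx Xy; apply: subspD => //; exact: subspN. Qed.

Lemma sublinear0 q : sublinear q -> q 0 = 0.
Proof. by move=> [_ /(_ 2 0 (ltr0Sn R 1) X0)]; rewrite scaler0 => h; lra. Qed.

Lemma sublinear_ge q x : sublinear q -> X x -> - q (- x) <= q x.
Proof.
move=> qs Xx; have := qs.1 x (- x) Xx (subspN Xx).
by rewrite subrr sublinear0 // => h; lra.
Qed.

(** Lowers [q] so that the value at [- y] is at most [- q y] (take [t = 1]). A functional that
    cannot be lowered in this way is additive along [y]. *)
Definition shave (q : V -> R) (y x : V) : R :=
  inf [set q (x + t *: y) - t * q y | t in [set t : R | 0 <= t]].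

(** Subadditivity on [t *: y = (x + t *: y) - x]. The bound makes [shave] a genuine infimum, since
    [inf] of a set unbounded below is a default value. *)
Lemma shave_lb q y x : sublinear q -> X x -> X y ->
  lbound [set q (x + t *: y) - t * q y | t in [set t : R | 0 <= t]] (- q (- x)).
Proof.
move=> qs Xx Xy _ [t /= t0 <-].
have Xty := subspZ t Xy.
have tE : q (t *: y) = t * q y.
  by move: t0; rewrite le_eqVlt => /orP[/eqP <-|t0];
    [rewrite scale0r mul0r sublinear0|rewrite qs.2].
have := qs.1 _ _ (subspD Xx Xty) (subspN Xx).
by rewrite addrAC subrr add0r tE => h; lra.
Qed.

Lemma shave_le q y x t : sublinear q -> X x -> X y -> 0 <= t ->
  shave q y x <= q (x + t *: y) - t * q y.
Proof.
move=> qs Xx Xy t0; apply: ge_inf; last by exists t.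
by exists (- q (- x)); exact: shave_lb.
Qed.

Lemma shave_ge q y x c : (forall t, 0 <= t -> c <= q (x + t *: y) - t * q y) ->
  c <= shave q y x.
Proof.
move=> h; apply: lb_le_inf; last by move=> _ [t t0 <-]; exact: h.
by exists (q (x + 0 *: y) - 0 * q y); exists 0 => //=.
Qed.

Lemma shave_lt q y x c : shave q y x < c ->
  exists2 t, 0 <= t & q (x + t *: y) - t * q y < c.
Proof.
move=> h; have [|_ [t t0 <-] ?] := inf_lt _ h; last by exists t.
by exists (q (x + 0 *: y) - 0 * q y); exists 0 => //=.
Qed.

Lemma shave_sublinear q y : sublinear q -> X y -> sublinear (shave q y).
Proof.
move=> qs Xy; split=> [x x' Xx Xx'|a x a0 Xx].
  apply/ler_addgt0Pr => e e0.
  have [|t t0 ht] := @shave_lt q y x (shave q y x + e / 2); first by lra.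
  have [|t' t'0 ht'] := @shave_lt q y x' (shave q y x' + e / 2); first by lra.
  apply: le_trans (shave_le qs (subspD Xx Xx') Xy (addr_ge0 t0 t'0)) _.
  rewrite scalerDl addrACA.
  have := qs.1 _ _ (subspD Xx (subspZ t Xy)) (subspD Xx' (subspZ t' Xy)).
  by rewrite mulrDl => h; lra.
have sc t : q (a *: x + (a * t) *: y) - a * t * q y = a * (q (x + t *: y) - t * q y).
  rewrite -scalerA -scalerDr qs.2 //; last exact/subspD/subspZ.
  by ring.
apply/eqP; rewrite eq_le; apply/andP; split.
  rewrite mulrC -ler_pdivrMr //; apply: shave_ge => t t0.
  rewrite ler_pdivrMr // [_ * a]mulrC -sc; apply: shave_le => //; first exact: subspZ.
  by rewrite mulr_ge0 // ltW.
apply: shave_ge => t t0.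
rewrite -[t](@mulVKf _ a) ?gt_eqF// sc ler_pM2l//; apply: shave_le => //.
by rewrite mulr_ge0 // invr_ge0 ltW.
Qed.

Lemma shave_le_id q y x : sublinear q -> X x -> X y -> shave q y x <= q x.
Proof.
move=> qs Xx Xy; apply: le_trans (shave_le qs Xx Xy (lexx 0)) _.
by rewrite scale0r addr0 mul0r subr0.
Qed.

(* A minimal sublinear functional is linear: [shave] cannot lower it. *)
Lemma hahn_banach (q : V -> R) (x0 : V) : sublinear q -> X x0 ->
  exists l : V -> R, [/\ forall a x y, X x -> X y -> l (a *: x + y) = a * l x + l y,
    forall x, X x -> l x <= q x & l x0 = q x0].
Proof.
move=> qs Xx0.
(* Staying below [shave q x0] forces [l (- x0) <= - q x0], hence equality at [x0]. *)
pose q0 := shave q x0; have q0s : sublinear q0 by exact: shave_sublinear.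
pose S := {r : V -> R | sublinear r /\ forall x, X x -> r x <= q0 x}.
(* The order is reversed, so that Zorn's lemma yields a minimal functional. *)
pose ge (r s : S) := `[< forall x, X x -> sval s x <= sval r x >].
have [||| [m [ms mq0]] mmin] := @ZL_preorder S (exist _ q0 (conj q0s (fun _ _ => lexx _))) ge.
- by move=> r; apply/asboolP.
- move=> r s t /asboolP rs /asboolP st; apply/asboolP => x Xx.
  by rewrite (le_trans (st _ Xx))// rs.
- move=> A Atot.
  have [[a0 Aa0]|A0] := pselect (exists a, A a); last first.
    by exists (exist _ q0 (conj q0s (fun _ _ => lexx _))) => s As; case: A0; exists s.
  pose f x := inf [set sval r x | r in A].
  have fle r x : A r -> X x -> f x <= sval r x.
    move=> Ar Xx; apply: ge_inf; last by exists r.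
    exists (- q0 (- x)) => _ [s As <-].
    apply: le_trans (sublinear_ge (svalP s).1 Xx).
    by rewrite lerN2; apply: (svalP s).2; exact: subspN.
  have fge x c : (forall r, A r -> c <= sval r x) -> c <= f x.
    move=> h; apply: lb_le_inf; first by exists (sval a0 x); exists a0.
    by move=> _ [r Ar <-]; exact: h.
  have flt x c : f x < c -> exists2 r, A r & sval r x < c.
    move=> h; have [|_ [r Ar <-] ?] := inf_lt _ h; last by exists r.
    by exists (sval a0 x); exists a0.
  have fs : sublinear f.
    split=> [x y Xx Xy|a x a0' Xx].
      apply/ler_addgt0Pr => e e0.
      have [|r Ar hr] := @flt x (f x + e / 2); first by lra.
      have [|s As hs] := @flt y (f y + e / 2); first by lra.
      (* In a chain the smaller of the two near-minimizers serves for both [x] and [y]. *)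
      have [/asboolP rs|/asboolP sr] := Atot r s Ar As.
        have h1 := fle _ _ As (subspD Xx Xy).
        by have := (svalP s).1.1 _ _ Xx Xy; have := rs _ Xx; lra.
      have h1 := fle _ _ Ar (subspD Xx Xy).
      by have := (svalP r).1.1 _ _ Xx Xy; have := sr _ Xy; lra.
    apply/eqP; rewrite eq_le; apply/andP; split.
      rewrite mulrC -ler_pdivrMr //; apply: fge => r Ar.
      rewrite ler_pdivrMr // mulrC -(svalP r).1.2 //; apply: fle => //.
      exact: subspZ.
    apply: fge => r Ar; rewrite (svalP r).1.2 // ler_pM2l //; exact: fle.
  have fq0 x : X x -> f x <= q0 x.
    by move=> Xx; apply: le_trans (fle _ _ Aa0 Xx) _; exact: (svalP a0).2.
  by exists (exist _ f (conj fs fq0)) => s As; apply/asboolP => x Xx; exact: fle.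
have mle y x : X y -> X x -> m x <= shave m y x.
  move=> Xy Xx.
  have hs : sublinear (shave m y) /\ forall x, X x -> shave m y x <= q0 x.
    split; first exact: shave_sublinear.
    by move=> z Xz; apply: le_trans (mq0 _ Xz); exact: shave_le_id.
  have := mmin (exist _ _ hs) => /(_ _)/asboolP; apply => //.
  by apply/asboolP => z Xz /=; exact: shave_le_id.
have mD x y : X x -> X y -> m (x + y) = m x + m y.
  move=> Xx Xy; apply/eqP; rewrite eq_le ms.1 //=.
  have := le_trans (mle y x Xy Xx) (shave_le ms Xx Xy ler01).
  by rewrite scale1r mul1r => h; lra.
have mN x : X x -> m (- x) = - m x.
  move=> Xx; have := mD x (- x) Xx (subspN Xx).
  by rewrite subrr sublinear0 // => h; lra.
have mZ a x : X x -> m (a *: x) = a * m x.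
  move=> Xx; have [a0|a0|->] := ltgtP a 0; last by rewrite scale0r mul0r sublinear0.
    have := ms.2 (- a) x; rewrite oppr_gt0 scaleNr mN; last exact: subspZ.
    by move=> /(_ a0 Xx); rewrite mulNr => /oppr_inj.
  by rewrite ms.2.
have q0q x : X x -> q0 x <= q x by move=> Xx; exact: shave_le_id.
exists m; split=> [a x y Xx Xy|x Xx|].
- by rewrite mD ?mZ //; exact: subspZ.
- exact: le_trans (mq0 _ Xx) (q0q _ Xx).
apply/eqP; rewrite eq_le (le_trans (mq0 _ Xx0) (q0q _ Xx0)) /=.
have := le_trans (mq0 _ (subspN Xx0)) (shave_le qs (subspN Xx0) Xx0 ler01).
by rewrite mN // scale1r addNr sublinear0 // mul1r => h; lra.
Qed.

End HahnBanach.

(** * Clarke cones in a seminormed space *)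

Section ClarkeCalculus.
Variables (R : realType) (V : lmodType R) (Xs : set V) (nm : V -> R).
Hypotheses (X0 : Xs 0) (XL : forall (a : R) x y, Xs x -> Xs y -> Xs (a *: x + y)).
Hypotheses (nm_ge0 : forall x, Xs x -> 0 <= nm x)
  (nmD : forall x y, Xs x -> Xs y -> nm (x + y) <= nm x + nm y)
  (nmZ : forall a x, Xs x -> nm (a *: x) = `|a| * nm x).
Variables (C : set V) (xb : V).
Hypotheses (CX : C `<=` Xs) (Cxb : C xb).

Let XD := subspD XL.
Let XZ := subspZ X0 XL.
Let XN := subspN X0 XL.
Let XB := subspB X0 XL.

Lemma seminorm0 : nm 0 = 0.
Proof. by rewrite -(scale0r 0) nmZ // normr0 mul0r. Qed.

Lemma seminormN x : Xs x -> nm (- x) = nm x.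
Proof. by move=> Xx; rewrite -scaleN1r nmZ // normrN1 mul1r. Qed.

Lemma distC_lb x : Xs x -> lbound [set nm (c - x) | c in C] 0.
Proof. by move=> Xx _ [c Cc <-]; apply/nm_ge0/XB => //; exact: CX. Qed.

Lemma distC_ge0 x : Xs x -> 0 <= distC nm C x.
Proof.
by move=> Xx; apply: lb_le_inf; [exists (nm (xb - x)); exists xb|exact: distC_lb].
Qed.

Lemma distC_le x c : Xs x -> C c -> distC nm C x <= nm (c - x).
Proof.
move=> Xx Cc; apply: ge_inf; last by exists c.
by exists 0; exact: distC_lb.
Qed.

Lemma distC_lt x e : distC nm C x < e -> exists2 c, C c & nm (c - x) < e.
Proof.
move=> h; have [|_ [c Cc <-] ?] := inf_lt _ h; last by exists c.
by exists (nm (xb - x)); exists xb.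
Qed.

Lemma distC_mem c : C c -> distC nm C c = 0.
Proof.
move=> Cc; apply/eqP; rewrite eq_le distC_ge0 ?andbT; last exact: CX.
by rewrite (le_trans (distC_le (CX Cc) Cc))// subrr seminorm0.
Qed.

Lemma distC_lip x y : Xs x -> Xs y -> distC nm C (x + y) <= distC nm C x + nm y.
Proof.
move=> Xx Xy; apply/ler_addgt0Pr => e e0.
have [|c Cc hc] := @distC_lt x (distC nm C x + e); first by lra.
apply: le_trans (distC_le (XD Xx Xy) Cc) _.
rewrite opprD addrA; have := nmD (XB (CX Cc) Xx) (XN Xy).
by rewrite seminormN // => h; lra.
Qed.

Let phi := distC nm C.

Definition dd_le (h : V) (c : R) := forall e, 0 < e -> exists2 del, 0 < del &
  forall x th, Xs x -> nm (x - xb) < del -> 0 < th -> th < del ->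
  phi (x + th *: h) - phi x <= (c + e) * th.

Lemma dd_leP h c : (clarke_dd Xs nm phi xb h <= c%:E)%E <-> dd_le h c.
Proof.
split=> [hc e e0|hc].
  have : (clarke_dd Xs nm phi xb h < (c + e)%:E)%E.
    by apply: le_lt_trans hc _; rewrite lte_fin ltrDl.
  move=> /ereal_inf_lt[_ [del /= del0 <-] hd]; exists del => // x th Xx xd th0 thd.
  rewrite -ler_pdivrMr // -lee_fin; apply: le_trans (ltW hd).
  by apply: ereal_sup_ubound; exists x, th.
apply/lee_addgt0Pr => e e0; have [del del0 hd] := hc _ e0.
apply: ge_ereal_inf; eexists; first by exists del.
apply: ge_ereal_sup => _ [x [th [Xx [xd [th0 [thd ->]]]]]].
by rewrite -EFinD lee_fin ler_pdivrMr //; exact: hd.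
Qed.

Let Q h := fine (clarke_dd Xs nm phi xb h).

Lemma dd_le_nm h : Xs h -> dd_le h (nm h).
Proof.
move=> Xh e e0; exists 1 => // x th Xx _ th0 _.
have := distC_lip Xx (XZ th Xh); rewrite nmZ // gtr0_norm // -/phi.
have : 0 < e * th by exact: mulr_gt0.
by rewrite mulrDl [nm h * _]mulrC => h1 h2; lra.
Qed.

(** The distance vanishes at the base point [xb], so the quotients taken there are nonnegative. With
    the upper bound [nm h] this makes the derivative finite, so that [Q] loses nothing. *)
Lemma clarke_dd_ge0 h : Xs h -> (0 <= clarke_dd Xs nm phi xb h)%E.
Proof.
move=> Xh; apply/ereal_infP => _ [del /= del0 <-].
apply: le_ereal_sup_tmp; exists ((phi (xb + (del / 2) *: h) - phi xb) / (del / 2))%:E.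
  exists xb, (del / 2); rewrite subrr seminorm0; split; first exact: CX.
  by split => //; split; first lra; split => //; lra.
rewrite lee_fin /phi (distC_mem Cxb) subr0 mulr_ge0 //; last by rewrite invr_ge0; lra.
by apply: distC_ge0; apply: XD; [exact: CX|exact: XZ].
Qed.

Lemma clarke_ddE h : Xs h -> clarke_dd Xs nm phi xb h = (Q h)%:E.
Proof.
move=> Xh; rewrite /Q fineK // ge0_fin_numE; last exact: clarke_dd_ge0.
by apply: le_lt_trans (ltry (nm h)); apply/dd_leP; exact: dd_le_nm.
Qed.

Lemma Q_leP h c : Xs h -> Q h <= c <-> dd_le h c.
Proof. by move=> Xh; rewrite -dd_leP clarke_ddE. Qed.

Lemma Q_sublinear : sublinear Xs Q.
Proof.
split=> [h k Xh Xk|a h a0 Xh].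
  apply/Q_leP; first exact: XD.
  move=> e e0; have e20 : 0 < e / 2 by lra.
  have [d1 d10 h1] := (Q_leP _ Xh).1 (lexx _) _ e20.
  have [d2 d20 h2] := (Q_leP _ Xk).1 (lexx _) _ e20.
  (* The step along [h] starts from [x + th *: k], so [th] must also keep this point within [d1] of
     [xb]; adding 1 avoids dividing by a zero seminorm. *)
  have k1 : 0 < nm k + 1 by have := nm_ge0 Xk; lra.
  pose d := Num.min d2 (Num.min (d1 / 2) (d1 / 2 / (nm k + 1))).
  have dd2 : d <= d2 by rewrite /d ge_min lexx.
  have dd1 : d <= d1 / 2 by rewrite /d !ge_min lexx orbT.
  have ddk : d <= d1 / 2 / (nm k + 1) by rewrite /d !ge_min lexx !orbT.
  have d0 : 0 < d by rewrite /d !lt_min d20 !divr_gt0.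
  exists d => // x th Xx xd th0 thd.
  have Xt := XZ th Xk.
  have := h2 x th Xx (lt_le_trans xd dd2) th0 (lt_le_trans thd dd2).
  have := h1 (x + th *: k) th (XD Xx Xt).
  rewrite -[x + _ + th *: h]addrA -scalerDr [k + h]addrC => h1' h2'.
  have : nm (x + th *: k - xb) < d1; last move=> /h1' /(_ th0 _)h3.
    rewrite addrAC.
    have := nmD (XB Xx (CX Cxb)) Xt; rewrite nmZ // gtr0_norm // => h3.
    apply: le_lt_trans h3 _.
    have : th * nm k <= d1 / 2.
      have : th * (nm k + 1) <= d1 / 2.
        by rewrite -ler_pdivlMr //; apply/ltW/(lt_le_trans thd).
      by rewrite mulrDr mulr1; lra.
    lra.
  have {h3} h3 := h3 ltac:(lra); move: h2' h3; rewrite !mulrDl => h2' h3; lra.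
(* Rescaling the step gives one inequality; using it for [a] and for [a^-1] gives equality. *)
have key b k : 0 < b -> Xs k -> Q (b *: k) <= b * Q k.
  move=> b0 Xk; apply/Q_leP; first exact: XZ.
  move=> e e0; have eb0 : 0 < e / b by rewrite divr_gt0.
  have [d d0 hd] := (Q_leP _ Xk).1 (lexx _) _ eb0.
  exists (Num.min d (d / b)); first by rewrite lt_min d0 divr_gt0.
  move=> x th Xx; rewrite !lt_min => /andP[xd _] th0 /andP[_ thd].
  have := hd x (th * b) Xx xd (mulr_gt0 th0 b0).
  rewrite -ltr_pdivlMr // => /(_ thd); rewrite scalerA => h1; apply: le_trans h1 _.
  rewrite le_eqVlt; apply/orP; left; apply/eqP; field.
  by rewrite gt_eqF.
apply/eqP; rewrite eq_le key //=.
have := key a^-1 (a *: h); rewrite invr_gt0 scalerA mulVf ?gt_eqF// scale1r.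
by move=> /(_ a0 (XZ _ Xh)); rewrite [_^-1 * _]mulrC ler_pdivlMr // mulrC.
Qed.

(** Boundedness is automatic: [Q <= nm] because the distance is 1-Lipschitz, and the same bound at
    [- x] controls [l] from below. *)
Lemma subdiffP l : clarke_subdiff Xs nm phi xb l <->
  (forall (a : R) x y, Xs x -> Xs y -> l (a *: x + y) = a * l x + l y) /\
  forall h, Xs h -> l h <= Q h.
Proof.
split=> [[[ll _] lQ]|[ll lQ]].
  by split=> // h Xh; have := lQ h Xh; rewrite clarke_ddE.
split; last by move=> h Xh; rewrite clarke_ddE // lee_fin lQ.
split=> //; exists 1 => x Xx; rewrite mul1r.
have lN : l (- x) = - l x.
  have l0 : l 0 = 0.
    by have := ll (-1) _ _ X0 X0; rewrite scaler0 addr0 mulN1r addNr.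
  by have := ll (-1) _ _ Xx X0; rewrite scaleN1r !addr0 mulN1r l0 addr0.
have Qn y : Xs y -> Q y <= nm y by move=> Xy; apply/Q_leP => //; exact: dd_le_nm.
have h1 := le_trans (lQ _ Xx) (Qn _ Xx).
have := le_trans (lQ _ (XN Xx)) (Qn _ (XN Xx)); rewrite lN seminormN // => h2.
by rewrite ler_norml; apply/andP; split; lra.
Qed.

Let K := [set l | exists (a : R) (l0 : V -> R),
  0 < a /\ clarke_subdiff Xs nm phi xb l0 /\ l = (fun x => a * l0 x)].

Lemma subdiff_attain h : Xs h -> exists2 l, clarke_subdiff Xs nm phi xb l & l h = Q h.
Proof.
move=> Xh; have [l [ll lQ lh]] := hahn_banach X0 XL Q_sublinear Xh.
by exists l => //; apply/subdiffP.
Qed.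

Lemma cone_subP l : K l ->
  forall (a : R) x y, Xs x -> Xs y -> l (a *: x + y) = a * l x + l y.
Proof.
move=> [a [l0 [a0 [/subdiffP[ll _] ->]]]] b x y Xx Xy /=.
by rewrite ll // mulrDr mulrCA.
Qed.

(** The subdifferential is convex: the mean of [l0] and [k0] with weights [a] and [b] is a
    subgradient, and the sum is [a + b] times it. *)
Lemma coneD l k : K l -> K k -> K (fun x => l x + k x).
Proof.
move=> [a [l0 [a0 [/subdiffP[ll lQ] ->]]]] [b [k0 [b0 [/subdiffP[kl kQ] ->]]]].
have ab0 : 0 < a + b by exact: addr_gt0.
exists (a + b), (fun x => (a * l0 x + b * k0 x) / (a + b)); split => //; split.
  apply/subdiffP; split=> [c x y Xx Xy|h Xh]; first by rewrite ll // kl //; ring.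
  rewrite ler_pdivrMr //.
  have := ler_wpM2l (ltW a0) (lQ _ Xh); have := ler_wpM2l (ltW b0) (kQ _ Xh).
  by rewrite mulrDr ![_ * Q h]mulrC => h1 h2; lra.
by apply/funext => x; rewrite mulrCA mulfV ?gt_eqF// mulr1.
Qed.

Lemma coneZ a l : 0 < a -> K l -> K (fun x => a * l x).
Proof.
move=> a0 [b [l0 [b0 [h ->]]]]; exists (a * b), l0; split; first exact: mulr_gt0.
by split=> //; apply/funext => x; rewrite mulrA.
Qed.

Lemma cone_normal l : K l -> clarke_normal Xs nm C xb l.
Proof.
move=> Kl; split; last by move=> F e _ _ e0; exists l; split=> // h _; rewrite subrr normr0.
split; first exact: cone_subP.
have [a [l0 [a0 [[[_ [M hM]] _] ->]]]] := Kl.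
by exists (a * M) => x Xx; rewrite normrM gtr0_norm // -mulrA ler_pM2l //; exact: hM.
Qed.

(** A sign condition at one vector survives the weak-star closure, because [[set h]] is an
    admissible test set. *)
Lemma tangent_coneP h : clarke_tangent Xs nm C xb h <-> Xs h /\ forall l, K l -> l h <= 0.
Proof.
split=> [[Xh hl]|[Xh hl]]; split=> // l; first by move=> /cone_normal/hl.
move=> [_ lcl]; apply/ler_addgt0Pr => e e0; rewrite add0r.
have [|_ ->|s [Ks /(_ h erefl)]] := lcl [set h] e _ _ e0 => //.
by have := hl _ Ks; rewrite ltr_norml => h1 /andP[h2 _]; lra.
Qed.

Lemma tangentP h : clarke_tangent Xs nm C xb h <-> Xs h /\ dd_le h 0.
Proof.
rewrite tangent_coneP; split=> -[Xh hl]; split=> //.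
  apply/Q_leP => //; have [l ld <-] := subdiff_attain Xh.
  by apply: hl; exists 1, l; split => //; split => //; apply/funext => x; rewrite mul1r.
move=> _ [a [l [a0 [/subdiffP[_ lQ] ->]]]].
have := lQ _ Xh; have := (Q_leP 0 Xh).2 hl => h1 h2.
by rewrite pmulr_rle0 // (le_trans h2).
Qed.

(** A general base point [x] can be replaced by an almost nearest [y] in [C]: since the distance is
    1-Lipschitz, this costs only [nm (y - x)], which is about [phi x]. *)
Lemma tangentP_mem h : clarke_tangent Xs nm C xb h <-> Xs h /\
  forall e, 0 < e -> exists2 del, 0 < del &
  forall y th, C y -> nm (y - xb) < del -> 0 < th -> th < del -> phi (y + th *: h) <= e * th.
Proof.
rewrite tangentP; split=> -[Xh hl]; split=> // e e0.
  have [del del0 hd] := hl _ e0; exists del => // y th Cy yd th0 thd.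
  by have := hd y th (CX Cy) yd th0 thd; rewrite add0r /phi (distC_mem Cy) subr0.
have [|del del0 hd] := hl (e / 2); first by lra.
(* [nm (y - xb)] will be at most [2 * nm (x - xb) + e / 2 * th], and these bounds keep it below
   [2 * del / 3 + del / 6]. *)
have d0 : 0 < Num.min (del / 3) (del / 3 / e).
  by rewrite lt_min; apply/andP; split; rewrite !divr_gt0.
exists (Num.min (del / 3) (del / 3 / e)) => // x th Xx.
rewrite !lt_min => /andP[xd _] th0 /andP[thd the].
have [|y Cy hy] := @distC_lt x (phi x + e / 2 * th).
  by rewrite -/phi ltrDl mulr_gt0 //; lra.
have phix : phi x <= nm (x - xb).
  rewrite -seminormN; last exact/XB/CX.
  by rewrite opprB; exact: distC_le.
have yx : nm (y - xb) <= nm (y - x) + nm (x - xb).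
  by rewrite -{1}(subrK x y) -addrA; apply: nmD; apply: XB => //; exact: CX.
move: the; rewrite ltr_pdivlMr // => the.
have := hd y th Cy _ th0 _.
move=> /(_ _ _)h1; have {h1} : phi (y + th *: h) <= e / 2 * th by apply: h1; lra.
have := distC_lip (XD (CX Cy) (XZ th Xh)) (XB Xx (CX Cy)).
rewrite -/phi -seminormN; last by apply: XB => //; exact: CX.
rewrite opprB [y + _]addrC -addrA [y + _]addrC subrK [_ + x]addrC => h1 h2.
by move: h1 h2 hy; rewrite add0r; lra.
Qed.

Lemma contingentP h : contingent Xs nm C xb h <-> Xs h /\
  forall del eta, 0 < del -> 0 < eta ->
  exists th, [/\ 0 < th, th < del & phi (xb + th *: h) < eta * th].
Proof.
split=> [[Xh h0]|[Xh hex]]; split=> //.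
  move=> del eta del0 eta0.
  have : (ereal_inf [set r | exists th, (0 < th)%R /\ (th < del)%R /\
      r = (phi (xb + th *: h) / th)%:E] <= 0)%E.
    by rewrite -h0; apply: ereal_sup_ubound; exists del.
  move=> /le_lt_trans /(_ (_ : (0 < eta%:E)%E)).
  rewrite lte_fin => /(_ eta0)/ereal_inf_lt[_ [th [th0 [thd ->]]]].
  by rewrite lte_fin ltr_pdivrMr // => ?; exists th.
apply/eqP; rewrite eq_le; apply/andP; split.
  apply: ge_ereal_sup => _ [del /= del0 <-]; apply/lee_addgt0Pr => eta eta0.
  have [th [th0 thd hth]] := hex _ _ del0 eta0.
  apply: ge_ereal_inf; exists (phi (xb + th *: h) / th)%:E; first by exists th.
  by rewrite add0e lee_fin ler_pdivrMr // ltW.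
apply: le_ereal_sup_tmp; eexists; first by exists 1; [exact: ltr01|reflexivity].
apply/ereal_infP => _ [th [th0 [_ ->]]]; rewrite lee_fin divr_ge0 //; last exact: ltW.
apply: distC_ge0; apply: XD; first exact: CX.
exact: XZ.
Qed.

(* The separating functional comes from Hahn-Banach applied, on the finitely
   many tested coordinates, to the distance to the generating cone. *)
Lemma normal_polar l : dual_elt Xs nm l ->
  (forall h, clarke_tangent Xs nm C xb h -> l h <= 0) -> clarke_normal Xs nm C xb l.
Proof.
move=> ld lT; split=> // F e finF FX e0; apply: contrapT => nex.
have [s Fs] := (finite_seqP F).1 finF.
pose n := size s; pose x (i : 'I_n) := s`_i.
have Fx i : F (x i) by rewrite Fs /=; apply: mem_nth.
have Xx i : Xs (x i) by exact: FX.
pose ev (k : V -> R) : 'rV[R]_n := \row_i k (x i).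
pose N (v : 'rV[R]_n) := \sum_i `|v 0 i|.
(* The distance, in the tested coordinates, to the image of the generating cone. It is at least [e]
   at [ev l], because no element of the cone approximates [l] on [F]. *)
pose q v := inf [set N (v - ev k) | k in K].
have [k0 Kk0] : exists k, K k.
  have [k kd _] := subdiff_attain X0; exists k, 1, k; split => //; split => //.
  by apply/funext => y; rewrite mul1r.
have N0 v : 0 <= N v by apply: sumr_ge0.
have qle v k : K k -> q v <= N (v - ev k).
  by move=> Kk; apply: ge_inf; [exists 0 => _ [? _ <-]|exists k].
have qge v c : (forall k, K k -> c <= N (v - ev k)) -> c <= q v.
  move=> h; apply: lb_le_inf; last by move=> _ [k Kk <-]; exact: h.
  by exists (N (v - ev k0)); exists k0.
have qlt v c : q v < c -> exists2 k, K k & N (v - ev k) < c.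
  move=> h; have [|_ [k Kk <-] ?] := inf_lt _ h; last by exists k.
  by exists (N (v - ev k0)); exists k0.
have NZ a v : 0 < a -> N (a *: v) = a * N v.
  move=> a0; rewrite /N mulr_sumr; apply: eq_bigr => i _.
  by rewrite mxE normrM gtr0_norm.
have qs : sublinear setT q.
  split=> [v w _ _|a v a0 _].
    apply/ler_addgt0Pr => eta eta0.
    have [|k Kk hk] := qlt v (q v + eta / 2); first by lra.
    have [|k' Kk' hk'] := qlt w (q w + eta / 2); first by lra.
    apply: le_trans (qle _ _ (coneD Kk Kk')) _.
    apply: (@le_trans _ _ (N (v - ev k) + N (w - ev k'))); last by lra.
    rewrite /N -big_split; apply: ler_sum => i _ /=.
    by rewrite !mxE opprD addrACA; exact: ler_normD.
  have evZ b k : ev (fun y => b * k y) = b *: ev k by apply/rowP => i; rewrite !mxE.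
  apply/eqP; rewrite eq_le; apply/andP; split.
    rewrite mulrC -ler_pdivrMr //; apply: qge => k Kk.
    by rewrite ler_pdivrMr // mulrC -NZ // scalerBr -evZ; apply: qle; exact: coneZ.
  apply: qge => k Kk.
  have -> : a *: v - ev k = a *: (v - ev (fun y => a^-1 * k y)).
    by rewrite evZ scalerBr scalerA mulfV ?gt_eqF// scale1r.
  by rewrite NZ // ler_pM2l //; apply/qle/coneZ => //; rewrite invr_gt0.
have [//|//|phi' [pl pq plv]] := @hahn_banach R _ setT _ _ q (ev l) qs I.
pose b i := phi' (delta_mx 0 i).
have phiE v : phi' v = \sum_i v 0 i * b i.
  have p0 : phi' 0 = 0.
    by have := pl (-1) 0 0 I I; rewrite scaler0 addr0 mulN1r addNr.
  rewrite {1}(row_sum_delta v).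
  elim/big_rec2: _ => [//|i u w _ hu]; by rewrite pl // hu.
(* This vector represents [phi']: [k h = phi' (ev k)] for [k] linear on [Xs]. As [phi' <= q] and [q]
   vanishes on the image of the cone, [h] is tangent; yet [l h = q (ev l) >= e]. *)
pose h := \sum_i b i *: x i.
have Xh : Xs h by apply: big_ind => // i _; exact: XZ.
have hE k : (forall (a : R) x y, Xs x -> Xs y -> k (a *: x + y) = a * k x + k y) ->
    k h = phi' (ev k).
  move=> kl; have k00 : k 0 = 0.
    by have := kl (-1) 0 0 X0 X0; rewrite scaler0 addr0 mulN1r addNr.
  rewrite phiE /h.
  have : Xs (\sum_i b i *: x i) /\ k (\sum_i b i *: x i) = \sum_i ev k 0 i * b i.
    elim/big_rec2: _ => [//|i u w _ [Xw hu]]; split; first exact: XL.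
    by rewrite kl // hu mxE mulrC.
  by case.
have : l h <= 0.
  apply: lT; apply/tangent_coneP; split=> // k Kk.
  rewrite hE; last exact: cone_subP.
  apply: le_trans (pq _ I) _; apply: le_trans (qle _ _ Kk) _.
  by rewrite subrr /N big1 // => i _; rewrite mxE normr0.
rewrite (hE _ ld.1) plv; apply/negP; rewrite -ltNge; apply: (lt_le_trans e0).
apply: qge => k Kk; rewrite leNgt; apply/negP => Nk; apply: nex.
exists k; split=> // y; rewrite Fs /= => /(nthP 0)[j js <-].
apply: le_lt_trans Nk; rewrite /N (bigD1 (Ordinal js)) //= !mxE distrC lerDl.
exact: sumr_ge0.
Qed.

End ClarkeCalculus.

(** * Souslin sets and measurable selections *)

Lemma natinv_lt (R : realType) (e : R) : 0 < e -> exists n : nat, n.+1%:R^-1 < e.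
Proof.
move=> e0; exists (Num.truncn e^-1).
by rewrite invf_plt ?posrE// truncnS_gt.
Qed.

Section MeasurableSets.
Context d (T : measurableType d).

(** This lemma and the next ones let measurability be read off the logical form of a formula with
    countable quantifiers. *)
Lemma mset_ex (I : countType) (P : I -> T -> Prop) :
  (forall i, measurable [set w | P i w]) -> measurable [set w | exists i, P i w].
Proof.
move=> mP; rewrite [X in measurable X](_ : _ = \bigcup_i [set w | P i w]).
  by apply: countable_bigcupT_measurable.
by apply/seteqP; split=> [w [i Pi]|w [i _ Pi]]; exists i.
Qed.

Lemma mset_not (P : T -> Prop) :
  measurable [set w | P w] -> measurable [set w | ~ P w].
Proof. by move=> /measurableC. Qed.

Lemma mset_all (I : countType) (P : I -> T -> Prop) :
  (forall i, measurable [set w | P i w]) -> measurable [set w | forall i, P i w].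
Proof.
move=> mP; rewrite [X in measurable X](_ : _ = [set w | ~ exists i, ~ P i w]).
  by apply: mset_not; apply: mset_ex => i; exact: mset_not.
apply/seteqP; split=> [w h [i]|w h i]; first by apply.
by apply: contrapT => nP; apply: h; exists i.
Qed.

Lemma mset_and (P Q : T -> Prop) : measurable [set w | P w] ->
  measurable [set w | Q w] -> measurable [set w | P w /\ Q w].
Proof. by move=> mP mQ; exact: measurableI. Qed.

Lemma mset_or (P Q : T -> Prop) : measurable [set w | P w] ->
  measurable [set w | Q w] -> measurable [set w | P w \/ Q w].
Proof. by move=> mP mQ; exact: measurableU. Qed.

Lemma mset_const (P : Prop) : measurable [set _ : T | P].
Proof.
have [p|p] := pselect P.
  by rewrite [X in measurable X](_ : _ = setT)//; apply/seteqP; split.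
by rewrite [X in measurable X](_ : _ = set0)//; apply/seteqP; split.
Qed.

Lemma mset_imp (P : Prop) (Q : T -> Prop) : (P -> measurable [set w | Q w]) ->
  measurable [set w | P -> Q w].
Proof.
move=> mQ; have [p|p] := pselect P.
  rewrite [X in measurable X](_ : _ = [set w | Q w]); first exact: mQ.
  by apply/seteqP; split=> w /= h; [exact: h|].
by rewrite [X in measurable X](_ : _ = setT)//; apply/seteqP; split=> w //= _ /p.
Qed.

(** Choosing the least index makes the choice measurable. *)
Lemma mset_first (P : nat -> T -> Prop) :
  (forall i, measurable [set w | P i w]) -> (forall w, exists i, P i w) ->
  exists2 N : T -> nat, forall w, P (N w) w & forall k, measurable [set w | N w = k].
Proof.
move=> mP exP.
have exP' w : exists i, `[< P i w >] by have [i Pi] := exP w; exists i; apply/asboolP.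
exists (fun w => ex_minn (exP' w)) => [w|k].
  by case: ex_minnP => i /asboolP.
rewrite [X in measurable X](_ : _ = [set w | P k w /\ forall i, (i < k)%N -> ~ P i w]).
  apply: mset_and => //; apply: mset_all => i.
  by apply: mset_imp => _; exact: mset_not.
apply/seteqP; split=> w /=.
  case: ex_minnP => i /asboolP Pi imin <-; split=> // j ji Pj.
  by have := imin j; rewrite leqNgt ji => /(_ (asboolT Pj)).
move=> [Pk kmin]; case: ex_minnP => i /asboolP Pi imin.
apply/eqP; rewrite eqn_leq imin ?asboolT//= leqNgt; apply/negP => ik.
exact: kmin Pi.
Qed.

(** [H] is the intersection of a minimizing sequence of measurable supersets. If [B] cut off
    positive mass, then the intersection of [H] with [B] would be a superset of measure below the
    infimum. *)
Lemma measurable_hull (R : realType) (mu : {finite_measure set T -> \bar R}) (P : set T) :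
  exists2 H, measurable H /\ P `<=` H &
    forall B, measurable B -> P `<=` B -> mu (H `\` B) = 0%E.
Proof.
pose I := ereal_inf [set mu B | B in [set B | measurable B /\ P `<=` B]].
have I0 : (0 <= I)%E by apply/ereal_infP => _ [B _ <-].
have muT B : measurable B -> (mu B < +oo)%E.
  by move=> mB; rewrite -ge0_fin_numE//; exact: fin_num_measure.
have Ifin : I \is a fin_num.
  rewrite ge0_fin_numE //; apply: le_lt_trans (muT setT measurableT).
  by apply: ge_ereal_inf; exists (mu setT) => //; exists setT.
have /choice[B hB] n : exists B, [/\ measurable B, P `<=` B & (mu B < I + n.+1%:R^-1%:E)%E].
  have := @lb_ereal_inf_adherent _ _ (n.+1%:R^-1) _ Ifin.
  by rewrite invr_gt0 ltr0Sn => /(_ isT)[_ [B [mB PB] <-] ?]; exists B.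
have mH : measurable (\bigcap_n B n) by apply: bigcapT_measurable => n; have [] := hB n.
exists (\bigcap_n B n).
  by split=> // w Pw n _; have [_ + _] := hB n; apply.
have muH : (mu (\bigcap_n B n) <= I)%E.
  apply/lee_addgt0Pr => e e0; have [n ne] := natinv_lt e0.
  have [mBn _ Bn] := hB n; apply: (@le_trans _ _ (mu (B n))).
    by apply: le_measure; rewrite ?inE //; exact: bigcap_inf.
  by apply: le_trans (ltW Bn) _; rewrite leeD2l // lee_fin ltW.
move=> D mD PD; apply/eqP; rewrite eq_le measure_ge0 andbT measureD //; last exact: muT.
rewrite sube_le0; apply: le_trans muH _; apply: ge_ereal_inf; eexists; last exact: lexx.
exists (\bigcap_n B n `&` D) => //; split; first exact: measurableI.
by move=> w Pw; split; [move=> n _; have [_ + _] := hB n; apply|exact: PD].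
Qed.

End MeasurableSets.

Section Souslin.
Import numFieldNormedType.Exports.
Context d (T : measurableType d) (R : realType) (E : completeNormedModType R).

Definition agree (m : nat) (s t : nat -> nat) := forall i, (i < m)%N -> s i = t i.

(* Instead of sets attached to the nodes of a tree, a scheme is a sequence of
   conditions on the whole branch, each of them locally constant: this makes
   countable unions and intersections a matter of recoding branches. *)
Definition souslin_scheme (A : nat -> (nat -> nat) -> set T)
    (F : nat -> (nat -> nat) -> set E) :=
  [/\ forall j s, measurable (A j s), forall j s, closed (F j s) &
    forall j, exists m, forall s t, agree m s t -> A j s = A j t /\ F j s = F j t].

Definition souslin_set (A : nat -> (nat -> nat) -> set T)
    (F : nat -> (nat -> nat) -> set E) :=
  [set z : T * E | exists s, forall j, A j s z.1 /\ F j s z.2].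

Definition souslin (G : set (T * E)) :=
  exists A F, souslin_scheme A F /\ G = souslin_set A F.

(** Conditions indexed by pairs are renumbered through [pickle]; numbers that code no pair carry the
    trivial condition. *)
Lemma souslin_pair (A : nat * nat -> (nat -> nat) -> set T)
    (F : nat * nat -> (nat -> nat) -> set E) :
  (forall j s, measurable (A j s)) -> (forall j s, closed (F j s)) ->
  (forall j, exists m, forall s t, agree m s t -> A j s = A j t /\ F j s = F j t) ->
  souslin [set z | exists s, forall j, A j s z.1 /\ F j s z.2].
Proof.
move=> mA cF dep.
pose A' j s := if unpickle j is Some jk then A jk s else setT.
pose F' j s := if unpickle j is Some jk then F jk s else setT.
exists A', F'; split.
  split=> j; rewrite /A' /F'; case: unpickle => [a|] //.
  by exists 0%N.
apply/seteqP; split=> z [s hs]; exists s => j.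
  by rewrite /A' /F'; case: unpickle.
by have := hs (pickle j); rewrite /A' /F' pickleK.
Qed.

(** The first coordinate of a branch names the set [G k], and the rest is a branch for it.
    Conditions of the other sets are switched off. *)
Lemma souslin_bigcup (G : nat -> set (T * E)) :
  (forall k, souslin (G k)) -> souslin (\bigcup_k G k).
Proof.
move=> /choice[A /choice[F AF]].
pose tl (s : nat -> nat) i := s i.+1.
pose A' (j : nat * nat) s := if s 0%N == j.1 then A j.1 j.2 (tl s) else setT.
pose F' (j : nat * nat) s := if s 0%N == j.1 then F j.1 j.2 (tl s) else setT.
rewrite (_ : \bigcup_k G k = [set z | exists s, forall j, A' j s z.1 /\ F' j s z.2]).
  apply: souslin_pair => [j s|j s|j]; have [[mA cF dep] _] := AF j.1; rewrite /A' /F'.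
  - by case: ifP.
  - by case: ifP => // _; exact: closedT.
  - have [m hm] := dep j.2; exists m.+1 => s t st.
    rewrite (st 0%N)//; case: ifP => // _; apply: hm => i im; exact: st.
apply/seteqP; split=> z.
  move=> [k _]; have [_ ->] := AF k; move=> [s hs].
  exists (fun i => if i is i'.+1 then s i' else k) => -[k' j]; rewrite /A' /F' /=.
  by case: eqP => // <-; exact: hs.
move=> [s hs]; exists (s 0%N) => //; have [_ ->] := AF (s 0%N).
by exists (tl s) => j; have := hs (s 0%N, j); rewrite /A' /F' /= eqxx.
Qed.

(** One branch encodes a branch for every [G k]: coordinate [i] of the [k]-th one is stored at
    [pickle (k, i)]. *)
Lemma souslin_bigcap (G : nat -> set (T * E)) :
  (forall k, souslin (G k)) -> souslin (\bigcap_k G k).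
Proof.
move=> /choice[A /choice[F AF]].
pose sub (k : nat) (s : nat -> nat) (i : nat) := s (pickle (k, i)).
pose A' (j : nat * nat) s := A j.1 j.2 (sub j.1 s).
pose F' (j : nat * nat) s := F j.1 j.2 (sub j.1 s).
rewrite (_ : \bigcap_k G k = [set z | exists s, forall j, A' j s z.1 /\ F' j s z.2]).
  apply: souslin_pair => [j s|j s|j]; have [[mA cF dep] _] := AF j.1; rewrite /A' /F' //.
  have [m hm] := dep j.2; exists (\max_(i < m) (pickle (j.1, nat_of_ord i)).+1)%N => s t st.
  apply: hm => i im; apply: st.
  exact: (@leq_bigmax _ (fun i : 'I_m => (pickle (j.1, nat_of_ord i)).+1) (Ordinal im)).
apply/seteqP; split=> z.
  move=> hz; have /choice[S hS] k : exists s, forall j, A k j s z.1 /\ F k j s z.2.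
    by have := hz k I; have [_ ->] := AF k.
  exists (fun n => if unpickle n is Some ki then S ki.1 ki.2 else 0%N) => j.
  rewrite /A' /F' (_ : sub _ _ = S j.1); first exact: hS.
  by apply/funext => i; rewrite /sub pickleK.
move=> [s hs] k _; have [_ ->] := AF k; exists (sub k s) => j.
exact: (hs (k, j)).
Qed.

Lemma souslin_rect (A : set T) (F : set E) : measurable A -> closed F -> souslin (A `*` F).
Proof.
move=> mA cF; exists (fun _ _ => A), (fun _ _ => F); split.
  by split=> // j; exists 0%N.
by apply/seteqP; split=> z; [exists (fun=> 0%N)|case=> _ /(_ 0%N)].
Qed.

Lemma souslin_setU G H : souslin G -> souslin H -> souslin (G `|` H).
Proof.
move=> sG sH; rewrite -bigcup2E; apply: souslin_bigcup => -[|[|k]] //=.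
by rewrite -(@set0X T E setT); apply: souslin_rect => //; exact: closedT.
Qed.

Lemma continuous_dist (y : E) : continuous (fun x => `|x - y| : R).
Proof.
move=> x; apply: (cvg_norm (f := fun x => x - y)).
by apply: cvgB; [exact: cvg_id|exact: cvg_cst].
Qed.

(** [U] is a countable union of the closed sets of points at distance at least [n.+1%:R^-1] from its
    complement. *)
Lemma souslin_open (U : set E) : open U -> souslin (setT `*` U).
Proof.
move=> oU.
pose F (n : nat) := \bigcap_(y in ~` U) [set x | n.+1%:R^-1 <= `|x - y|].
have cF n : closed (F n).
  apply: closed_bigI => y _.
  by have /continuous_closedP/(_ _ (@closed_ge _ n.+1%:R^-1)) := @continuous_dist y.
rewrite (_ : setT `*` U = \bigcup_n (setT `*` F n)).
  by apply: souslin_bigcup => n; exact: souslin_rect.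
apply/seteqP; split=> [[w x] [_ /= Ux]|[w x] [n _ [_ /= Fx]]].
  have /nbhs_ballP[e /= e0 he] : nbhs x U by exact: open_nbhs_nbhs.
  have [n ne] := natinv_lt e0; exists n => //; split=> // y nUy /=.
  rewrite leNgt; apply/negP => xy; apply: nUy; apply: he.
  by rewrite -ball_normE /=; exact: lt_trans ne.
split=> //=; apply: contrapT => nUx.
by have := Fx _ nUx; rewrite /= subrr normr0 leNgt invr_gt0 ltr0Sn.
Qed.

Definition rectangles : set (set (T * E)) :=
  [set AB | exists (A : set T) (B : set E),
          measurable A /\ <<s open >> B /\ AB = A `*` B].

(** Souslin sets are not stable under complement, so the induction carries the complement along: the
    sets Souslin together with their complement form a sigma-algebra. *)
Lemma souslin_borel (B : set E) : <<s open >> B -> souslin (setT `*` B).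
Proof.
suff h : <<s @open E >> `<=` [set B | souslin (setT `*` B) /\ souslin (setT `*` ~` B)].
  by move=> /h[].
apply: smallest_sub => [|U oU]; last first.
  by split; [exact: souslin_open|apply: souslin_rect => //; exact: open_closedC].
split=> [|C [sC sNC]|F hF].
- by rewrite /= setC0; split; apply: souslin_rect => //; exact: closed0.
- by rewrite /= setTD setCK.
- split.
    rewrite /= setX_bigcupr; apply: souslin_bigcup => n; exact: (hF n).1.
  rewrite setC_bigcup (_ : setT `*` _ = \bigcap_n (setT `*` ~` F n)).
    by apply: souslin_bigcap => n; exact: (hF n).2.
  apply/seteqP; split=> [z [_ h] n _|z h]; first by split=> //; exact: h.
  by split=> // n _; have [] := h n.
Qed.

Lemma souslin_measurable (G : set (T * E)) : <<s rectangles >> G -> souslin G.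
Proof.
suff h : <<s rectangles >> `<=` [set G | souslin G /\ souslin (~` G)].
  by move=> /h[].
apply: smallest_sub => [|_ [A [B [mA [bB ->]]]]].
  split=> [|C [sC sNC]|F hF].
  - rewrite /= setC0 -(@set0X T E setT) -(@setXTT T E); split; apply: souslin_rect => //; exact: closed0.
  - by rewrite /= setTD setCK.
  - split; first by apply: souslin_bigcup => n; exact: (hF n).1.
    by rewrite setC_bigcup; apply: souslin_bigcap => n; exact: (hF n).2.
have bNB : <<s open >> (~` B).
  by have [_ + _] := smallest_sigma_algebra setT (@open E); rewrite -setTD; apply.
split.
  rewrite (_ : A `*` B = \bigcap_n (if n is 0%N then A `*` setT else setT `*` B)).
    apply: souslin_bigcap => -[|n]; last exact: souslin_borel.
    by apply: souslin_rect => //; exact: closedT.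
  apply/seteqP; split=> [z [Az Bz] [|n] _ //|z h].
  by split; [have [] := h 0%N I|have [] := h 1%N I].
rewrite (_ : ~` (A `*` B) = (~` A `*` setT) `|` (setT `*` ~` B)).
  apply: souslin_setU; last exact: souslin_borel.
  by apply: souslin_rect; [exact: measurableC|exact: closedT].
apply/seteqP; split=> [z h|z [[/= nA _]|[_ /= nB]] []//].
by have [Az|Az] := pselect (A z.1); [right; split=> // Bz; exact: h|left].
Qed.

End Souslin.

(** * Aumann's measurable selection theorem *)

Section Selection.
Import numFieldNormedType.Exports.
Context d (T : measurableType d) (R : realType) (E : completeNormedModType R).
Variables (mu : {finite_measure set T -> \bar R}) (e : nat -> E).
Hypothesis e_dense : forall x eps, 0 < eps -> exists n, `|x - e n| < eps.

(** The original branch moves to the even coordinates, and the odd ones record ever closer points of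
    the dense sequence. Points satisfying more and more conditions of one branch then form a Cauchy
    sequence. *)
Lemma souslin_refine (G : set (T * E)) : souslin G ->
  exists A F, [/\ souslin_scheme A F, G = souslin_set A F &
    forall i s x, F i.*2.+1 s x -> `|x - e (s i.*2.+1)| <= i.+1%:R^-1].
Proof.
move=> [A [F [[mA cF dep] ->]]].
pose ev (s : nat -> nat) i := s i.*2.
pose A' j s := if odd j then setT else A j./2 (ev s).
pose F' j s := if odd j then [set x | `|x - e (s j)| <= (j./2).+1%:R^-1]
               else F j./2 (ev s).
exists A', F'; split.
- split=> j.
  + by move=> s; rewrite /A'; case: ifP.
  + move=> s; rewrite /F'; case: ifP => // _.
    by have /continuous_closedP/(_ _ (@closed_le _ (j./2).+1%:R^-1)) := @continuous_dist R E (e (s j)).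
  + rewrite /A' /F'; case: (odd j).
      by exists j.+1 => s t st; rewrite st.
    have [m hm] := dep j./2; exists m.*2 => s t st; apply: hm => i im.
    by apply: st; rewrite ltn_double.
- apply/seteqP; split=> z [s hs].
    have /choice[b hb] n : exists k, `|z.2 - e k| < n.+1%:R^-1.
      by apply: e_dense; rewrite invr_gt0.
    exists (fun i => if odd i then b i./2 else s i./2) => j; rewrite /A' /F'.
    have -> : ev (fun i => if odd i then b i./2 else s i./2) = s.
      by apply/funext => i; rewrite /ev odd_double doubleK.
    by case: ifP => // _; split=> //=; exact: ltW.
  exists (ev s) => j; have := hs j.*2.
  by rewrite /A' /F' odd_double doubleK.
- move=> i s x; rewrite /F' /= odd_double /= uphalf_double; exact.
Qed.

(* The approximating sets are measurable hulls (Szpilrajn-Marczewski), so the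
   hull of a node is covered, up to a null set, by the hulls of its children. *)
Lemma measurable_selection (G : set (T * E)) : <<s @rectangles _ T R E >> G ->
  exists (D : set T) (f : T -> E), [/\ measurable D, borel_meas f,
    forall w, D w -> G (w, f w) &
    mu.-negligible ([set w | exists x, G (w, x)] `\` D)].
Proof.
move=> /souslin_measurable/souslin_refine[A [F [[mA cF /choice[m dep]] -> small]]].
(* A prefix is padded by zeros to a branch; for a [live] condition the padding has no influence. *)
pose ext (s : seq nat) : nat -> nat := nth 0%N s.
pose live (s : seq nat) j := (j < size s)%N && (m j <= size s)%N.
(* The projection of the part of [G] whose branches extend [s]; it need not be measurable. *)
pose B s := [set w | exists x t, agree (size s) (ext s) t /\
  forall j, A j t w /\ F j t x].
(* A measurable superset of [B s]: the quantifier over [x] does not involve [w], so it is a constant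
   condition. *)
pose C s := [set w | (exists x, forall j, live s j -> F j (ext s) x) /\
  forall j, live s j -> A j (ext s) w].
have mC s : measurable (C s).
  apply: mset_and; first exact: mset_const.
  by apply: mset_all => j; apply: mset_imp => _; exact: mA.
have BC s : B s `<=` C s.
  move=> w [x [t [st ht]]]; split.
    exists x => j /andP[_ mj]; have [_ ->] := dep j (ext s) t (fun i im => st i (leq_trans im mj)).
    by have [] := ht j.
  move=> j /andP[_ mj]; have [-> _] := dep j (ext s) t (fun i im => st i (leq_trans im mj)).
  by have [] := ht j.
(* Cutting the hull down to [C s] keeps it a hull and makes the live conditions hold on it. *)
have /choice[H hH] s : exists H, [/\ measurable H, B s `<=` H, H `<=` C s &
    forall D, measurable D -> B s `<=` D -> mu (H `\` D) = 0%E].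
  have [H [mH BH] hH] := measurable_hull mu (B s).
  exists (H `&` C s); split; first exact: measurableI.
  - by move=> w Bw; split; [exact: BH|exact: BC].
  - exact: subIsetr.
  move=> D mD BD; apply/eqP; rewrite eq_le measure_ge0 andbT -(hH _ mD BD).
  apply: le_measure; rewrite ?inE; [apply: measurableD => //; exact: measurableI|exact: measurableD|].
  by apply: setSD; exact: subIsetl.
have mH s : measurable (H s) by have [] := hH s.
(* The points where a branch through [s] cannot be continued. This set is null, because [B s] is
   covered by the sets [B (rcons s i)]. *)
pose L s := H s `\` [set w | exists i, H (rcons s i) w].
have mL s : measurable (L s) by apply: measurableD => //; apply: mset_ex => i; exact: mH.
have L0 s : mu.-negligible (L s).
  apply/negligibleP => //; have [_ _ _] := hH s; apply; first by apply: mset_ex => i; exact: mH.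
  move=> w [x [t [st ht]]]; exists (t (size s)); have [_ + _ _] := hH (rcons s (t (size s))).
  apply; exists x, t; split=> // i; rewrite size_rcons ltnS leq_eqVlt /ext nth_rcons.
  by case/orP => [/eqP ->|ilt]; rewrite ?ltnn ?eqxx// ilt -st.
pose N := [set w | exists s, L s w].
have mN : measurable N by rewrite /N; apply: mset_ex => s; exact: mL.
have N0 : mu.-negligible N.
  rewrite [X in negligible _ X](_ : N = \bigcup_k (if unpickle k is Some s then L s else set0)).
    by apply: negligible_bigcup => k; case: unpickle => // ; exact: negligible_set0.
  apply/seteqP; split=> [w [s Ls]|w [k _]]; first by exists (pickle s); rewrite ?pickleK.
  by case: unpickle => // s Ls; exists s.
(* The second alternative makes the choice total; on [D] it never occurs along the branch. *)
have /choice[step hstep] s : exists N : T -> nat,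
    (forall w, H (rcons s (N w)) w \/ ~ exists i, H (rcons s i) w) /\
    forall k, measurable [set w | N w = k].
  have [|w|n hn mn] := @mset_first _ _ (fun i w => H (rcons s i) w \/ ~ exists i, H (rcons s i) w).
  - move=> i; apply: mset_or; first exact: mH.
    by apply: mset_not; apply: mset_ex => i'; exact: mH.
  - by have [[i Hi]|nex] := pselect (exists i, H (rcons s i) w); [exists i; left|exists 0%N; right].
  by exists n.
pose pref w := fix pref n := if n is n'.+1 then rcons (pref n') (step (pref n') w) else [::].
pose br w n := step (pref w n) w.
have size_pref w n : size (pref w n) = n by elim: n => //= n IH; rewrite size_rcons IH.
have pref_br w n i : (i < n)%N -> ext (pref w n) i = br w i.
  elim: n => // n IH; rewrite ltnS leq_eqVlt /= /ext nth_rcons size_pref.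
  by case/orP => [/eqP ->|ltin]; rewrite ?ltnn ?eqxx// ltin; exact: IH.
have mpref n s : measurable [set w | pref w n = s].
  elim: n s => [|n IH] s; first exact: (mset_const _ ([::] = s)).
  rewrite [X in measurable X](_ : _ = [set w | exists s', pref w n = s' /\
      exists i, step s' w = i /\ rcons s' i = s]).
    apply: mset_ex => s'; apply: mset_and => //.
    apply: mset_ex => i; apply: mset_and; last exact: mset_const.
    exact: (hstep s').2.
  apply/seteqP; split=> w /=; first by move=> <-; exists (pref w n); split=> //; exists (step (pref w n) w).
  by move=> [s' [-> [i [-> ->]]]].
have mbr n k : measurable [set w | br w n = k].
  rewrite [X in measurable X](_ : _ = [set w | exists s, pref w n = s /\ step s w = k]).
    by apply: mset_ex => s; apply: mset_and => //; exact: (hstep s).2.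
  by apply/seteqP; split=> w /=; [exists (pref w n)|move=> [s [<-]]].
pose D := H [::] `\` N.
have mD : measurable D by exact: measurableD.
have Dpref w n : D w -> H (pref w n) w.
  move=> [H0 Nw]; elim: n => //= n IH.
  have [//|nex] := (hstep (pref w n)).1 w.
  by exfalso; apply: Nw; exists (pref w n).
have liveP w j n : (maxn j.+1 (m j) <= n)%N -> live (pref w n) j.
  by rewrite geq_max /live size_pref.
have depP w j n : (maxn j.+1 (m j) <= n)%N ->
    A j (ext (pref w n)) = A j (br w) /\ F j (ext (pref w n)) = F j (br w).
  rewrite geq_max => /andP[_ mn]; apply: dep => i im; apply: pref_br.
  exact: leq_trans mn.
have sel w : D w -> exists x, forall j, A j (br w) w /\ F j (br w) x.
  move=> Dw.
  (* [y n] satisfies the conditions decided by the first [n] coordinates, so each condition holds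
     from some rank on; closedness passes it to the limit. *)
  have /choice[y hy] n : exists x, forall j, live (pref w n) j -> F j (ext (pref w n)) x.
    by have [_ _ /(_ w (Dpref w n Dw))[] ] := hH (pref w n).
  have yF j n : (maxn j.+1 (m j) <= n)%N -> F j (br w) (y n).
    by move=> jn; have := hy n j (liveP _ _ _ jn); rewrite (depP _ _ _ jn).2.
  have cy : cvgn y.
    apply: cauchy_cvg; apply: cauchy_exP => eps /= eps0.
    have [i ie] := natinv_lt eps0; exists (e (br w i.*2.+1)).
    exists (maxn i.*2.+2 (m i.*2.+1)) => // n /= /yF/small ny.
    rewrite -ball_normE /= distrC; exact: le_lt_trans ie.
  exists (limn y) => j; split.
    have jn := leqnn (maxn j.+1 (m j)).
    have [_ _ /(_ w (Dpref w (maxn j.+1 (m j)) Dw))[_ hA] _] := hH (pref w (maxn j.+1 (m j))).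
    by have := hA _ (liveP _ _ _ jn); rewrite (depP _ _ _ jn).1.
  apply: (@closed_cvg _ _ _ eventually_filter y (F j (br w))) cy => //.
  by exists (maxn j.+1 (m j)) => // n /= /yF.
have /choice[f hf] w : exists x, (D w -> forall j, A j (br w) w /\ F j (br w) x) /\
    (~ D w -> x = 0).
  have [Dw|nDw] := pselect (D w); last by exists 0.
  by have [x hx] := sel w Dw; exists x.
exists D, f; split=> //.
- move=> U oU.
  (* The odd coordinates of the branch locate [f w]: it lies in [U] exactly when one of the recorded
     closed balls does, a condition on countably many measurable indices. *)
  rewrite [X in measurable X](_ : _ = [set w | (~ D w /\ U 0) \/ (D w /\ exists i, exists k,
      br w i.*2.+1 = k /\ forall x, `|x - e k| <= i.+1%:R^-1 -> U x)]).
    apply: mset_or.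
      apply: mset_and; first exact: mset_not.
      exact: mset_const.
    apply: mset_and => //; apply: mset_ex => i; apply: mset_ex => k.
    by apply: mset_and => //; exact: mset_const.
  apply/seteqP; split=> w /=.
    have [Dw|nDw] := pselect (D w); last by rewrite (hf w).2 //; left.
    move=> Ufw; right; split => //.
    have /nbhs_ballP[eps /= eps0 he] : nbhs (f w) U by exact: open_nbhs_nbhs.
    have [i ie] : exists i : nat, i.+1%:R^-1 < eps / 2 by apply: natinv_lt; lra.
    exists i, (br w i.*2.+1); split=> // x hx; apply: he; rewrite -ball_normE /=.
    have := small _ _ _ ((hf w).1 Dw i.*2.+1).2 => h1.
    apply: le_lt_trans (ler_distD (e (br w i.*2.+1)) _ _) _.
    rewrite (splitr eps) ltrD //; first exact: le_lt_trans ie.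
    by rewrite distrC; exact: le_lt_trans ie.
  move=> [[nDw U0]|[Dw [i [k [hk kU]]]]]; first by rewrite (hf w).2.
  by apply: kU; rewrite -hk; apply: small; exact: ((hf w).1 Dw i.*2.+1).2.
- by move=> w Dw; exists (br w); exact: (hf w).1.
apply: negligibleS N0 => w /= [[x [s hs]] nDw]; apply: contrapT => Nw; apply: nDw; split=> //.
have [_ + _ _] := hH [::]; apply; exists x, s; split=> //.
Qed.

End Selection.

(** * Measurability of vector-valued maps *)

Lemma dense_sequence (R : realType) (E : normedModType R) :
  (exists D : set E, countable D /\ closure D = [set: E]) ->
  exists e : nat -> E, forall x eps, 0 < eps -> exists n, `|x - e n| < eps.
Proof.
move=> [D [cD clD]].
have near x eps : 0 < eps -> exists2 y, D y & `|x - y| < eps.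
  move=> eps0; have : closure D x by rewrite clD.
  move=> /(_ (ball x eps) (nbhsx_ballx _ _ eps0))[y [Dy]].
  by rewrite -ball_normE; exists y.
have [y0 Dy0 _] := near 0 1 ltr01.
have /pfcard_geP[D0|[f]] : (D #<= [set: nat])%card by [].
  by move: Dy0; rewrite D0.
exists f => x eps eps0; have [y Dy xy] := near x eps eps0.
by have [n _ fn] := 'surj_f Dy; exists n; rewrite fn.
Qed.

Section MeasurableReal.
Context d (T : measurableType d) (R : realType).

Lemma measurable_fun_lt (f : T -> R) :
  (forall r, measurable [set w | f w < r]) -> measurable_fun setT f.
Proof.
move=> mf; apply: (measurability _ (RGenInftyO.measurableE R)).
move=> _ [_ [r ->] <-]; rewrite setTI [X in measurable X](_ : _ = [set w | f w < r]) //.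
Qed.

Lemma mset_lt (f g : T -> R) : measurable_fun setT f -> measurable_fun setT g ->
  measurable [set w | f w < g w].
Proof.
move=> mf mg; have := measurable_fun_ltr mf mg => /(_ measurableT [set true]).
by rewrite setTI; apply.
Qed.

End MeasurableReal.

(** * Caratheodory functions and composition with measurable maps *)

Section Caratheodory.
Import numFieldNormedType.Exports.
Context d (T : measurableType d) (R : realType) (E : completeNormedModType R).
Variable (e : nat -> E).
Hypothesis e_dense : forall x eps, 0 < eps -> exists n, `|x - e n| < eps.

Lemma mset_ball (f : T -> E) c r : borel_meas f -> measurable [set w | `|f w - c| < r].
Proof.
move=> mf; have := mf _ (@ball_open _ _ c r).
rewrite [X in measurable X -> _](_ : _ = [set w | `|f w - c| < r]) //.
by apply/seteqP; split=> w; rewrite /= -ball_normE /= distrC.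
Qed.

(** [F (f w) (g w)] lies in [U] exactly when [F] maps into [U] the product of two equal small balls,
    centred in the dense sequence, that contain [f w] and [g w]. *)
Lemma borel_meas_comp2 (F : E -> E -> E) (f g : T -> E) :
  (forall U x y, open U -> U (F x y) -> exists2 eps, 0 < eps &
     forall x' y', `|x - x'| < eps -> `|y - y'| < eps -> U (F x' y')) ->
  borel_meas f -> borel_meas g -> borel_meas (fun w => F (f w) (g w)).
Proof.
move=> cF mf mg U oU.
rewrite [X in measurable X](_ : _ = [set w | exists n, exists k, exists l,
  (`|f w - e k| < n.+1%:R^-1 /\ `|g w - e l| < n.+1%:R^-1) /\
  forall x y, `|x - e k| < n.+1%:R^-1 -> `|y - e l| < n.+1%:R^-1 -> U (F x y)]).
  apply: mset_ex => n; apply: mset_ex => k; apply: mset_ex => l.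
  apply: mset_and; last exact: mset_const.
  by apply: mset_and; exact: mset_ball.
apply/seteqP; split=> w /=; last by move=> [n [k [l [[fk gl]]]]]; exact.
move=> /(cF _ _ _ oU)[eps eps0 h].
have [n ne] : exists n : nat, n.+1%:R^-1 < eps / 2 by apply: natinv_lt; lra.
have n0 : 0 < n.+1%:R^-1 :> R by rewrite invr_gt0.
have [k fk] := e_dense (f w) n0; have [l gl] := e_dense (g w) n0.
exists n, k, l; split=> // x y xk yl; apply: h.
  rewrite (le_lt_trans (ler_distD (e k) _ _))// (splitr eps) ltrD//; first exact: lt_trans ne.
  by rewrite distrC; exact: lt_trans ne.
rewrite (le_lt_trans (ler_distD (e l) _ _))// (splitr eps) ltrD//; first exact: lt_trans ne.
by rewrite distrC; exact: lt_trans ne.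
Qed.

Lemma borel_meas_linear (a : R) (f g : T -> E) :
  borel_meas f -> borel_meas g -> borel_meas (fun w => a *: f w + g w).
Proof.
apply: (@borel_meas_comp2 (fun x y => a *: x + y)) => U x y oU Uxy.
have /nbhs_ballP[eps /= eps0 he] : nbhs (a *: x + y) U by exact: open_nbhs_nbhs.
have a1 : 0 < `|a| + 1 by rewrite ltr_pwDr.
exists (eps / (`|a| + 1)); first by rewrite divr_gt0.
move=> x' y' xx yy; apply: he; rewrite -ball_normE /=.
rewrite opprD addrACA -scalerBr; apply: le_lt_trans (ler_normD _ _) _.
rewrite normrZ; move: xx yy; rewrite !ltr_pdivlMr // mulrDr mulr1 => xx yy.
have h1 : `|a| * `|x - x'| <= `|a| * (eps / (`|a| + 1)).
  by apply: ler_wpM2l => //; rewrite ler_pdivlMr //; apply: ltW; rewrite mulrDr mulr1.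
have h2 : `|y - y'| < eps / (`|a| + 1).
  by rewrite ltr_pdivlMr // mulrDr mulr1.
have h3 : `|a| * (eps / (`|a| + 1)) + eps / (`|a| + 1) = eps.
  by field; rewrite gt_eqF.
lra.
Qed.

Lemma borel_meas_cst (x : E) : borel_meas (fun _ : T => x).
Proof. by move=> U _; exact: (mset_const _ (U x)). Qed.

Lemma borel_meas_if (A : set T) (f g : T -> E) : measurable A ->
  borel_meas f -> borel_meas g -> borel_meas (fun w => if w \in A then f w else g w).
Proof.
move=> mA mf mg U oU.
rewrite [X in measurable X](_ : _ = [set w | (A w /\ U (f w)) \/ (~ A w /\ U (g w))]).
  apply: mset_or; apply: mset_and => //; [exact: mf|exact: mset_not|exact: mg].
apply/seteqP; split=> w /=; case: ifPn; rewrite ?inE ?notin_setE.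
- by left.
- by right.
- by move=> Aw [[]|[]].
- by move=> Aw [[]|[]].
Qed.

Lemma borel_meas_countable (N : T -> nat) (f : nat -> T -> E) :
  (forall k, measurable [set w | N w = k]) -> (forall k, borel_meas (f k)) ->
  borel_meas (fun w => f (N w) w).
Proof.
move=> mN mf U oU.
rewrite [X in measurable X](_ : _ = [set w | exists k, N w = k /\ U (f k w)]).
  by apply: mset_ex => k; apply: mset_and => //; exact: mf.
by apply/seteqP; split=> w /=; [exists (N w)|move=> [k [->]]].
Qed.

(** The constant may vary with [w], as required for the functionals [g w]. *)
Definition lipschitz_fibers (phi : T -> E -> R) :=
  forall w, exists K, forall x y, `|phi w x - phi w y| <= K * `|x - y|.

(** [phi w x < r] means that points of the dense sequence arbitrarily near [x] have values below [r]
    by a fixed margin. The margin keeps the inequality strict in the limit. *)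
Lemma caratheodory_graph (phi : T -> E -> R) r :
  (forall x, measurable_fun setT (phi ^~ x)) -> lipschitz_fibers phi ->
  <<s @rectangles _ T R E >> [set z | phi z.1 z.2 < r].
Proof.
move=> mphi lphi.
pose P := g_sigma_algebraType (@rectangles _ T R E).
suff : measurable ([set z | phi z.1 z.2 < r] : set P) by [].
rewrite [X in measurable X](_ : _ = [set z : P | exists m : nat, forall n : nat, exists k,
    phi z.1 (e k) < r - m.+1%:R^-1 /\ `|z.2 - e k| < n.+1%:R^-1]).
  apply: mset_ex => m; apply: mset_all => n; apply: mset_ex => k.
  suff : <<s @rectangles _ T R E >> ([set w | phi w (e k) < r - m.+1%:R^-1] `*`
     [set x | `|x - e k| < n.+1%:R^-1]) by [].
  apply: sub_sigma_algebra; do 2!eexists; split; [|split; last reflexivity].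
    by apply: mset_lt; [exact: mphi|exact: measurable_cst].
  apply: sub_sigma_algebra.
  rewrite (_ : [set x | _] = ball (e k) n.+1%:R^-1); first exact: ball_open.
  by apply/seteqP; split=> x; rewrite -ball_normE /= distrC.
apply/seteqP; split=> -[w x] /=; have [K hK] := lphi w.
  move=> pr; have [m hm] : exists m : nat, m.+1%:R^-1 < (r - phi w x) / 2 by apply: natinv_lt; lra.
  exists m => n.
  have K1 : 0 < `|K| + 1 by rewrite ltr_pwDr.
  have d0 : 0 < Num.min n.+1%:R^-1 ((r - phi w x) / 2 / (`|K| + 1)).
    by rewrite lt_min invr_gt0 ltr0Sn /= !divr_gt0 // subr_gt0.
  have [k] := e_dense x d0; rewrite lt_min => /andP[xk1 xk2]; exists k; split=> //.
  have h1 := hK (e k) x.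
  have h2 : K * `|e k - x| <= (`|K| + 1) * `|e k - x|.
    by apply: ler_wpM2r => //; rewrite (le_trans (ler_norm K)) // lerDl.
  have h3 : (`|K| + 1) * `|e k - x| < (r - phi w x) / 2.
    by rewrite mulrC -ltr_pdivlMr // distrC.
  by move: hm (ler_norm (phi w (e k) - phi w x)); set a := m.+1%:R^-1 => hm h4; lra.
move=> [m hm]; rewrite ltNge; apply/negP => rp.
have m0 : 0 < m.+1%:R^-1 :> R by rewrite invr_gt0.
have K1 : 0 < `|K| + 1 by rewrite ltr_pwDr.
have [n ne] : exists n : nat, n.+1%:R^-1 < m.+1%:R^-1 / (`|K| + 1).
  by apply: natinv_lt; rewrite divr_gt0.
have [k [pk xk]] := hm n.
have h1 := hK x (e k).
have h2 : K * `|x - e k| <= (`|K| + 1) * `|x - e k|.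
  by apply: ler_wpM2r => //; rewrite (le_trans (ler_norm K)) // lerDl.
have h3 : (`|K| + 1) * `|x - e k| < m.+1%:R^-1.
  by rewrite mulrC -ltr_pdivlMr //; exact: lt_trans ne.
by move: pk h3 (ler_norm (phi w x - phi w (e k))); set a := m.+1%:R^-1 => pk h3 h4; lra.
Qed.

Lemma measurable_section (G : set (T * E)) (f : T -> E) : borel_meas f ->
  <<s @rectangles _ T R E >> G -> measurable [set w | G (w, f w)].
Proof.
move=> mf; move: G.
suff h : <<s @rectangles _ T R E >> `<=` [set G | measurable [set w | G (w, f w)]] by [].
have mB : <<s @open E >> `<=` [set B | measurable [set w | B (f w)]].
  apply: smallest_sub => [|U oU]; last exact: mf.
  split=> [|B mB|F mF] /=.
  - exact: (mset_const _ False).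
  - by apply: mset_and; [exact: (mset_const _ True)|exact: mset_not].
  - rewrite [X in measurable X](_ : _ = [set w | exists n, F n (f w)]); first exact: mset_ex.
    by apply/seteqP; split=> w /= [n]; [move=> _; exists n|exists n].
apply: smallest_sub => [|_ [A [B [mA [/mB bB ->]]]]]; last exact: mset_and.
split=> [|B mB'|F mF] /=.
- exact: (mset_const _ False).
- by apply: mset_and; [exact: (mset_const _ True)|exact: mset_not].
- rewrite [X in measurable X](_ : _ = [set w | exists n, F n (w, f w)]); first exact: mset_ex.
  by apply/seteqP; split=> w /= [n]; [move=> _; exists n|exists n].
Qed.

Lemma measurable_caratheodory (phi : T -> E -> R) (f : T -> E) :
  (forall x, measurable_fun setT (phi ^~ x)) -> lipschitz_fibers phi ->
  borel_meas f -> measurable_fun setT (fun w => phi w (f w)).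
Proof.
move=> mphi lphi mf; apply: measurable_fun_lt => r.
exact: (measurable_section mf (caratheodory_graph r mphi lphi)).
Qed.

Lemma measurable_norm_fun (f : T -> E) : borel_meas f -> measurable_fun setT (fun w => `|f w|).
Proof.
move=> mf; apply: measurable_fun_lt => r.
rewrite [X in measurable X](_ : _ = [set w | `|f w - 0| < r]); first exact: mset_ball.
by apply/seteqP; split=> w /=; rewrite subr0.
Qed.

End Caratheodory.

(** * The space of p-integrable maps *)

Section SummableIntegrals.
Import numFieldNormedType.Exports.
Context d (T : measurableType d) (R : realType) (mu : {measure set T -> \bar R}).

(** The integrals add up to at most 1, so the series is finite almost everywhere and its terms tend
    to zero there. *)
Lemma ae_cvg0_of_summable (F : nat -> T -> R) :
  (forall n, measurable_fun setT (F n)) -> (forall n w, 0 <= F n w) ->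
  (forall n, (\int[mu]_w (F n w)%:E <= (1 / (2 ^ n.+1)%:R)%:E)%E) ->
  {ae mu, forall w, forall eta, 0 < eta -> exists N, forall n, (N <= n)%N -> F n w < eta}.
Proof.
move=> mF F0 IF.
have mEF n : measurable_fun setT (fun w => (F n w)%:E) by exact/measurable_EFinP.
pose S w := (\sum_(0 <= n <oo) (F n w)%:E)%E.
have mS : measurable_fun setT S by apply: ge0_emeasurable_sum => // n w _ _; rewrite lee_fin.
have S0 w : (0 <= S w)%E by apply: nneseries_ge0 => n _ _; rewrite lee_fin.
have iS : mu.-integrable setT S.
  apply/integrableP; split => //.
  under eq_integral do rewrite gee0_abs //.
  rewrite integral_nneseries //; last by move=> n w _; rewrite lee_fin.
  apply: le_lt_trans (ltry 1).
  apply: le_trans (@epsilon_trick0 R 1 xpredT ler01).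
  by apply: lee_nneseries => n _; [move=> _; apply: integral_ge0 => w _; rewrite lee_fin|exact: IF].
have := integrable_ae measurableT iS; apply: filterS => w /(_ I) Sw eta eta0.
have Sw' : (S w < +oo)%E by rewrite -ge0_fin_numE.
have h := @nneseries_tail_cvg R (fun n => (F n w)%:E) xpredT Sw' (fun n _ => F0 n w).
have /fine_cvgP[_ /cvgrPdist_lt /(_ _ eta0)[N _ hN]] := h.
have [[N' _ hN'] _] := (fine_cvgP _ _).1 h.
exists (maxn N N') => n; rewrite geq_max => /andP[Nn N'n].
have := hN n Nn; rewrite /= sub0r normrN => hl; apply: le_lt_trans hl.
apply: le_trans (ler_norm _); rewrite -lee_fin fineK; last exact: hN'.
have := @nneseries_lim_ge R (fun n => (F n w)%:E) xpredT n n.+1.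
by rewrite big_nat1; apply => k _ _; rewrite lee_fin.
Qed.

End SummableIntegrals.

Section LpSpace.
Import numFieldNormedType.Exports.
Context d (T : measurableType d) (R : realType) (E : completeNormedModType R).
Variables (mu : {finite_measure set T -> \bar R}) (e : nat -> E).
Hypothesis e_dense : forall x eps, 0 < eps -> exists n, `|x - e n| < eps.
Variables (p : R) (hp : 1 <= p).
Implicit Types (f g h : T -> E) (u v : T -> R).

Let p0 : 0 < p. Proof. exact: lt_le_trans hp. Qed.
Let p_neq0 : p != 0. Proof. by rewrite gt_eqF. Qed.

Lemma powR_pK (x : R) : 0 <= x -> (x `^ p) `^ p^-1 = x.
Proof. by move=> x0; rewrite -powRrM mulfV // powRr1. Qed.

Lemma powR_p_le (x y : R) : 0 <= x -> 0 <= y -> x `^ p <= y `^ p -> x <= y.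
Proof.
move=> x0 y0 h; have p1 : 0 <= p^-1 by rewrite invr_ge0 ltW.
by have := ge0_ler_powR p1 (powR_ge0 _ _) (powR_ge0 _ _) h; rewrite !powR_pK.
Qed.

Lemma measurableT_comp_powR (q : R) u : measurable_fun setT u ->
  measurable_fun setT (fun w => u w `^ q).
Proof. exact: (@measurableT_comp _ _ _ _ _ _ (@powR R ^~ q)). Qed.

Definition powint u : \bar R := (\int[mu]_w (u w `^ p)%:E)%E.

Lemma measurable_powEFin u : measurable_fun setT u ->
  measurable_fun setT (fun w => (u w `^ p)%:E).
Proof. by move=> mu'; apply/measurable_EFinP; exact: measurableT_comp_powR. Qed.

Lemma powint_ge0 u : (0 <= powint u)%E.
Proof. by apply: integral_ge0 => w _; rewrite lee_fin powR_ge0. Qed.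

Lemma powint_le u v : measurable_fun setT u -> measurable_fun setT v ->
  (forall w, 0 <= u w) -> (forall w, 0 <= v w) -> {ae mu, forall w, u w <= v w} ->
  (powint u <= powint v)%E.
Proof.
move=> mu' mv u0 v0 uv; apply: ae_ge0_le_integral => //.
- by move=> w _; rewrite lee_fin powR_ge0.
- exact: measurable_powEFin.
- by move=> w _; rewrite lee_fin powR_ge0.
- exact: measurable_powEFin.
by apply: filterS uv => w uvw _; rewrite lee_fin ge0_ler_powR ?nnegrE // ltW.
Qed.

Lemma powint_cst (c : R) : 0 <= c -> (powint (fun _ => c) < +oo)%E.
Proof.
move=> c0; rewrite /powint integral_cst //.
by rewrite lte_mul_pinfty ?lee_fin ?powR_ge0 // -ge0_fin_numE // fin_num_measure.
Qed.

Lemma powint_scale (a : R) u : measurable_fun setT u -> (forall w, 0 <= u w) -> 0 <= a ->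
  powint (fun w => a * u w) = ((a `^ p)%:E * powint u)%E.
Proof.
move=> mu' u0 a0; rewrite /powint -ge0_integralZl //.
- by apply: eq_integral => w _; rewrite powRM // EFinM.
- exact: measurable_powEFin.
- by move=> w _; rewrite lee_fin powR_ge0.
- by rewrite lee_fin powR_ge0.
Qed.

(** Uses [u + v <= 2 * max (u, v)], whose [p]-th power is at most [2 ^ p] times the sum of the
    powers. *)
Lemma powint_add_fin u v : measurable_fun setT u -> measurable_fun setT v ->
  (forall w, 0 <= u w) -> (forall w, 0 <= v w) ->
  (powint u < +oo)%E -> (powint v < +oo)%E -> (powint (fun w => (u w + v w)%R) < +oo)%E.
Proof.
move=> mu' mv u0 v0 iu iv.
apply: (@le_lt_trans _ _ (\int[mu]_w (((2 `^ p) * (u w `^ p))%:E + ((2 `^ p) * (v w `^ p))%:E))%E).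
  apply: ge0_le_integral => //.
  - by move=> w _; rewrite lee_fin powR_ge0.
  - by apply: measurable_powEFin; exact: measurable_funD.
  - apply: emeasurable_funD; apply/measurable_EFinP; apply: measurable_funM => //;
    exact: measurableT_comp_powR.
  move=> w _; rewrite -EFinD lee_fin -mulrDr.
  have m0 : 0 <= Num.max (u w) (v w) by rewrite le_max u0.
  apply: (@le_trans _ _ ((2 * Num.max (u w) (v w)) `^ p)).
    rewrite ge0_ler_powR ?nnegrE //; [exact: ltW|exact: addr_ge0|exact: mulr_ge0|].
    by rewrite mulr_natl mulr2n lerD // le_max lexx ?orbT.
  rewrite powRM // ler_wpM2l ?powR_ge0 //.
  by case: (leP (u w) (v w)) => _; rewrite ?lerDl ?lerDr powR_ge0.
rewrite ge0_integralD //; last 4 first.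
- by move=> w _; rewrite lee_fin mulr_ge0 ?powR_ge0.
- by apply/measurable_EFinP; apply: measurable_funM => //; exact: measurableT_comp_powR.
- by move=> w _; rewrite lee_fin mulr_ge0 ?powR_ge0.
- by apply/measurable_EFinP; apply: measurable_funM => //; exact: measurableT_comp_powR.
have fin x : measurable_fun setT x -> (powint x < +oo)%E ->
    (\int[mu]_w (2 `^ p * x w `^ p)%:E < +oo)%E.
  move=> mx ix; under eq_integral => w _ do rewrite EFinM.
  rewrite ge0_integralZl //.
  - by rewrite lte_mul_pinfty ?lee_fin ?powR_ge0.
  - exact: measurable_powEFin.
  - by move=> w _; rewrite lee_fin powR_ge0.
by rewrite lte_add_pinfty ?fin.
Qed.

Lemma Lp_linear (a : R) f g : Lp mu p f -> Lp mu p g -> Lp mu p (a *: f + g).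
Proof.
move=> [mf If] [mg Ig].
have mfg : borel_meas (a *: f + g) by exact: (borel_meas_linear e_dense).
split; first exact: mfg.
have mnf := measurable_norm_fun mf; have mng := measurable_norm_fun mg.
have maf : measurable_fun setT (fun w => `|a| * `|f w|) by exact: measurable_funM.
apply: (@le_lt_trans _ _ (powint (fun w => `|a| * `|f w| + `|g w|))).
  apply: powint_le => //.
  - exact: measurable_norm_fun.
  - exact: measurable_funD.
  - apply: filterE => w; rewrite -normrZ; exact: ler_normD.
have af0 w : 0 <= `|a| * `|f w| by rewrite mulr_ge0.
apply: (powint_add_fin maf mng af0 (fun=> normr_ge0 _) _ Ig).
rewrite (powint_scale mnf (fun=> normr_ge0 _) (normr_ge0 a)).
by rewrite lte_mul_pinfty // ?lee_fin ?powR_ge0.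
Qed.

Lemma Lp0 : Lp mu p (0 : T -> E).
Proof.
split; first exact: borel_meas_cst.
have := powint_cst (lexx 0); congr (_ < _)%E; apply: eq_integral => w _.
by rewrite normr0.
Qed.

Lemma powint_Lp f : Lp mu p f -> powint (fun w => `|f w|) = ((Lpnorm mu p f) `^ p)%:E.
Proof.
move=> [mf If]; rewrite /Lpnorm -powRrM mulVf // powRr1; last exact/fine_ge0/powint_ge0.
by rewrite fineK // ge0_fin_numE //; exact: powint_ge0.
Qed.

Lemma Lpnorm_ge0 f : 0 <= Lpnorm mu p f.
Proof. exact: powR_ge0. Qed.

Lemma Lnorm_powint u : (forall w, 0 <= u w) ->
  'N[mu]_p%:E[EFin \o u]%E = (powint u `^ p^-1)%E.
Proof.
move=> u0; rewrite unlock; congr (_ `^ _)%E; apply: eq_integral => w _.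
by rewrite /= ger0_norm // poweR_EFin.
Qed.

Lemma Lnorm_Lp f : Lp mu p f ->
  'N[mu]_p%:E[EFin \o (fun w => `|f w|%R)]%E = (Lpnorm mu p f)%:E.
Proof.
move=> Lf; rewrite Lnorm_powint // powint_Lp // poweR_EFin powR_pK //.
exact: Lpnorm_ge0.
Qed.

Lemma Lpnorm_powint_le f (c : R) : Lp mu p f -> 0 <= c ->
  (powint (fun w => `|f w|%R) <= (c `^ p)%:E)%E -> Lpnorm mu p f <= c.
Proof.
move=> Lf c0; rewrite powint_Lp // lee_fin => h.
by apply: powR_p_le => //; exact: Lpnorm_ge0.
Qed.

(** Minkowski's inequality for bounds on [p]-th powers of real functions, so that it also applies to
    pointwise distances. *)
Lemma Lpnorm_minkowski u v (a b : R) : measurable_fun setT u -> measurable_fun setT v ->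
  (forall w, 0 <= u w) -> (forall w, 0 <= v w) -> 0 <= a -> 0 <= b ->
  (powint u <= (a `^ p)%:E)%E -> (powint v <= (b `^ p)%:E)%E ->
  (powint (fun w => (u w + v w)%R) <= ((a + b) `^ p)%:E)%E.
Proof.
move=> mu' mv u0 v0 a0 b0 ua vb.
have uv0 w : 0 <= u w + v w by rewrite addr_ge0.
have root x c : (forall w, 0 <= x w) -> 0 <= c -> (powint x <= (c `^ p)%:E)%E ->
    ('N[mu]_p%:E[EFin \o x] <= c%:E)%E.
  move=> x0 c0 xc; rewrite Lnorm_powint //.
  have := gt0_ler_poweR (_ : 0 <= p^-1) => /(_ _ _ _ _ _ xc).
  rewrite poweR_EFin powR_pK //; apply.
  - by rewrite invr_ge0 ltW.
  - by rewrite in_itv /= powint_ge0 leey.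
  - by rewrite in_itv /= lee_fin powR_ge0 leey.
have := le_trans (minkowski_EFin mu mu' mv hp) (leeD (root _ _ u0 a0 ua) (root _ _ v0 b0 vb)).
have -> : powint (fun w => (u w + v w)%R) = ('N[mu]_p%:E[EFin \o (u \+ v)%R] `^ p)%E.
  rewrite poweR_Lnorm //; apply: eq_integral => w _ /=.
  by rewrite ger0_norm // poweR_EFin.
move=> h; rewrite -EFinD in h; rewrite -poweR_EFin.
apply: gt0_ler_poweR => //; first exact: ltW.
- by rewrite in_itv /= Lnorm_ge0 leey.
- by rewrite in_itv /= lee_fin addr_ge0 // leey.
Qed.

Lemma Lpnorm_triangle f g : Lp mu p f -> Lp mu p g ->
  Lpnorm mu p (f + g) <= Lpnorm mu p f + Lpnorm mu p g.
Proof.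
move=> Lf Lg.
have Lfg : Lp mu p (f + g) by rewrite -[f]scale1r; exact: Lp_linear.
apply: Lpnorm_powint_le => //; first by rewrite addr_ge0 // Lpnorm_ge0.
have mnf := measurable_norm_fun Lf.1; have mng := measurable_norm_fun Lg.1.
apply: (@le_trans _ _ (powint (fun w => `|f w| + `|g w|))).
  apply: powint_le => //.
  - exact: measurable_norm_fun Lfg.1.
  - exact: measurable_funD.
  - by apply: filterE => w; exact: ler_normD.
by apply: Lpnorm_minkowski => //; rewrite ?Lpnorm_ge0 ?powint_Lp.
Qed.

Lemma Lpnorm_scale (a : R) f : Lp mu p f -> Lpnorm mu p (a *: f) = `|a| * Lpnorm mu p f.
Proof.
move=> Lf; rewrite {1}/Lpnorm.
have -> : (\int[mu]_w (`|(a *: f) w| `^ p)%:E = ((`|a| * Lpnorm mu p f) `^ p)%:E)%E.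
  transitivity (powint (fun w => `|a| * `|f w|)).
    by apply: eq_integral => w _; rewrite -normrZ.
  rewrite powint_scale //; last exact: measurable_norm_fun Lf.1.
  by rewrite powint_Lp // -EFinM powRM ?Lpnorm_ge0.
by rewrite /= powR_pK // mulr_ge0 // Lpnorm_ge0.
Qed.

(** The rate makes the integrals of the [p]-th powers summable, so the whole sequence converges
    a.e.; choosing sequences this fast replaces the extraction of subsequences. *)
Lemma ae_cvg0_of_fast (f_ : nat -> T -> E) : (forall n, Lp mu p (f_ n)) ->
  (forall n, Lpnorm mu p (f_ n) <= (1 / (2 ^ n.+1)%:R) `^ p^-1) ->
  {ae mu, forall w, forall eta, 0 < eta -> exists N, forall n, (N <= n)%N -> `|f_ n w| < eta}.
Proof.
move=> Lf fn.
have h : forall n, (\int[mu]_w (`|f_ n w| `^ p)%:E <= (1 / (2 ^ n.+1)%:R)%:E)%E.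
  move=> n; rewrite -/(powint (fun w => `|f_ n w|)) powint_Lp // lee_fin.
  have := ge0_ler_powR (ltW p0) (Lpnorm_ge0 _) (powR_ge0 _ _) (fn n).
  by rewrite -powRrM mulVf // powRr1 // divr_ge0.
have := @ae_cvg0_of_summable _ _ _ mu (fun n w => `|f_ n w| `^ p) _ _ h.
move=> /(_ _ _)H; have {}H := H (fun n => measurableT_comp_powR p (measurable_norm_fun (Lf n).1)) (fun n w => powR_ge0 _ _).
apply: filterS H => w H eta eta0.
have [|N hN] := H (eta `^ p); first exact: powR_gt0.
exists N => n Nn; rewrite ltNge; apply/negP => le.
have := hN n Nn; rewrite ltNge => /negP; apply.
by rewrite ge0_ler_powR ?nnegrE // ltW.
Qed.

End LpSpace.

(** * Functionals on [E] and their pairing with [Lp] *)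

Section DualNorm.
Import numFieldNormedType.Exports.
Context (R : realType) (E : normedModType R) (l : E -> R).
Hypothesis ld : dual_elt [set: E] (@Num.Def.normr _ E) l.

Lemma dual_elt0 : l 0 = 0.
Proof. by have := ld.1 (-1) 0 0 I I; rewrite scaler0 addr0 mulN1r addNr. Qed.

Lemma dual_eltZ a x : l (a *: x) = a * l x.
Proof. by have := ld.1 a x 0 I I; rewrite !addr0 dual_elt0 addr0. Qed.

Lemma dual_eltB x y : l (x - y) = l x - l y.
Proof. by have := ld.1 (-1) y x I I; rewrite scaleN1r addrC mulN1r addrC => ->; rewrite addrC. Qed.

Lemma dual_norm_ge0 : (0 <= dual_norm l)%E.
Proof.
apply: le_ereal_sup_tmp; exists (`|l 0|)%:E; last by rewrite lee_fin.
by exists 0 => //=; rewrite normr0.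
Qed.

Lemma dual_norm_fin : dual_norm l \is a fin_num.
Proof.
have [_ [K hK]] := ld; rewrite ge0_fin_numE ?dual_norm_ge0 //.
apply: (@le_lt_trans _ _ (`|K|)%:E); last exact: ltry.
apply: ge_ereal_sup => _ [x /= x1 <-]; rewrite lee_fin.
apply: le_trans (hK x I) _; apply: le_trans (ler_norm _) _.
by rewrite normrM normr_id ler_piMr.
Qed.

Lemma dual_norm_bound x : `|l x| <= fine (dual_norm l) * `|x|.
Proof.
have [->|x0] := eqVneq x 0; first by rewrite dual_elt0 !normr0 mulr0.
have nx : 0 < `|x| by rewrite normr_gt0.
rewrite -ler_pdivrMr // -lee_fin fineK ?dual_norm_fin //.
apply: ereal_sup_ubound; exists (`|x|^-1 *: x).
  by rewrite /= normrZ normfV normr_id mulVf // gt_eqF.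
by rewrite dual_eltZ normrM normfV normr_id mulrC.
Qed.

Lemma dual_lipschitz x y : `|l x - l y| <= fine (dual_norm l) * `|x - y|.
Proof. by rewrite -dual_eltB; exact: dual_norm_bound. Qed.

End DualNorm.

Section Pairing.
Import numFieldNormedType.Exports.
Context d (T : measurableType d) (R : realType) (E : completeNormedModType R).
Variables (mu : {finite_measure set T -> \bar R}) (e : nat -> E).
Hypothesis e_dense : forall x eps, 0 < eps -> exists n, `|x - e n| < eps.
Variables (p : R) (hp : 1 <= p) (g : T -> E -> R).
Hypothesis hg : Lq_wstar mu p g.

Let G w := fine (dual_norm (g w)).

Let G0 w : 0 <= G w. Proof. exact/fine_ge0/dual_norm_ge0. Qed.

Let mG : measurable_fun setT G. Proof. by have [_ [_ []]] := hg. Qed.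

Lemma measurable_pairing (f : T -> E) : borel_meas f ->
  measurable_fun setT (fun w => g w (f w)).
Proof.
have [gd [gm _]] := hg.
apply: (measurable_caratheodory e_dense) => // w.
by exists (G w) => x y; exact: dual_lipschitz.
Qed.

Lemma holder_bound : exists2 K : R, 0 <= K & forall f : T -> E, Lp mu p f ->
  (\int[mu]_w (G w * `|f w|)%R%:E <= (K * Lpnorm mu p f)%:E)%E.
Proof.
have [_ [_ [_ hq]]] := hg.
have mGf (f : T -> E) : Lp mu p f -> measurable_fun setT (fun w => (G w * `|f w|)%:E).
  move=> [mf _]; apply/measurable_EFinP; apply: measurable_funM => //.
  exact: measurable_norm_fun.
have [p1|p1] := eqVneq p 1.
  (* The conjugate exponent is infinite here, so the bound comes from the essential bound [c] on the
     dual norms. *)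
  move: hq; rewrite p1 eqxx => -[c hc]; exists `|c| => // f Lf.
  have -> : (`|c| * Lpnorm mu 1 f)%:E = (\int[mu]_w ((`|c| * `|f w|)%R)%:E)%E.
    have := powint_Lp (lexx 1) Lf; rewrite powRr1 ?Lpnorm_ge0 // EFinM => <-.
    rewrite /powint -ge0_integralZl //.
    - by apply: eq_integral => w _; rewrite powRr1 // EFinM.
    - apply: measurable_powEFin; exact: measurable_norm_fun Lf.1.
  apply: ae_ge0_le_integral => //.
  - by move=> w _; rewrite lee_fin mulr_ge0.
  - by apply: mGf; rewrite p1.
  - apply/measurable_EFinP; apply: measurable_funM => //.
    exact: measurable_norm_fun Lf.1.
  apply: filterS hc => w hc _; rewrite lee_fin ler_wpM2r //.
  apply: le_trans (ler_norm c); rewrite -lee_fin fineK //.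
  by apply: dual_norm_fin; have [] := hg.
rewrite (negbTE p1) in hq.
have p_gt1 : 1 < p by rewrite lt_neqAle eq_sym p1.
set q := p / (p - 1) in hq.
have q0 : 0 < q by rewrite divr_gt0 ?subr_gt0 //; exact: lt_trans p_gt1.
have pq : p^-1 + q^-1 = 1.
  by rewrite /q invf_div; field; rewrite gt_eqF // (lt_trans ltr01).
pose N := ('N[mu]_q%:E[EFin \o G])%E.
have NE : N = ((\int[mu]_w ((G w) `^ q)%:E) `^ q^-1)%E.
  rewrite /N unlock; congr (_ `^ _)%E; apply: eq_integral => w _.
  by rewrite /= ger0_norm // poweR_EFin.
have Nfin : N \is a fin_num.
  by rewrite ge0_fin_numE ?Lnorm_ge0 // NE poweR_lty.
exists (fine N) => [|f Lf]; first by rewrite fine_ge0 // Lnorm_ge0.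
have := hoelder mu mG (measurable_norm_fun Lf.1) q0 (lt_trans ltr01 p_gt1).
rewrite addrC => /(_ pq); rewrite Lnorm_Lp // Lnorm1 [(fine N * _)%:E]EFinM fineK //.
apply: le_trans; rewrite le_eqVlt; apply/orP; left; apply/eqP.
by apply: eq_integral => w _; rewrite /= ger0_norm // mulr_ge0.
Qed.

Lemma integrable_pairing (f : T -> E) : Lp mu p f ->
  mu.-integrable setT (EFin \o (fun w => g w (f w))).
Proof.
move=> Lf; have [K K0 hK] := holder_bound.
have [gd _] := hg.
have mGf : measurable_fun setT (fun w => (G w * `|f w|)%:E).
  apply/measurable_EFinP; apply: measurable_funM => //.
  exact: measurable_norm_fun Lf.1.
apply: (@le_integrable _ _ _ mu _ measurableT _ (fun w => (G w * `|f w|)%:E)).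
- by apply/measurable_EFinP; exact: measurable_pairing Lf.1.
- move=> w _ /=; rewrite lee_fin; apply: le_trans (ler_norm _).
  exact: dual_norm_bound.
apply/integrableP; split=> //.
under eq_integral => w _ do rewrite gee0_abs ?lee_fin ?mulr_ge0 //.
by apply: le_lt_trans (hK _ Lf) _; exact: ltry.
Qed.

Lemma pairing_dual : dual_elt (Lp mu p) (Lpnorm mu p) (pairing mu g).
Proof.
have [gd _] := hg; split.
  move=> a f h Lf Lh; rewrite /pairing.
  have ia := integrable_pairing Lf; have ih := integrable_pairing Lh.
  rewrite -RintegralZl // -RintegralD //.
    by apply: eq_Rintegral => w _; rewrite (gd w).1.
  have := integrableZl measurableT a ia.
  by congr (_.-integrable _ _); apply/funext => w /=; rewrite EFinM.
have [K K0 hK] := holder_bound; exists K => f Lf.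
apply: le_trans (le_normr_Rintegral measurableT (integrable_pairing Lf)) _.
rewrite /Rintegral -lee_fin fineK; last first.
  have /integrable_abse/integrable_fin_num := integrable_pairing Lf; exact.
apply: le_trans (hK _ Lf); apply: ge0_le_integral => //.
- have := measurable_pairing Lf.1 => h; apply/measurable_EFinP.
  exact: measurableT_comp.
- apply/measurable_EFinP; apply: measurable_funM => //.
  exact: measurable_norm_fun Lf.1.
- by move=> w _; rewrite lee_fin; exact: dual_norm_bound.
Qed.

End Pairing.

(** * Castaing representation and distances *)

Section Castaing.
Import numFieldNormedType.Exports.
Context d (T : measurableType d) (R : realType) (E : completeNormedModType R).
Variables (mu : {finite_measure set T -> \bar R}) (e : nat -> E).
Hypothesis e_dense : forall x eps, 0 < eps -> exists n, `|x - e n| < eps.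
Variables (M : T -> set E) (fb : T -> E).
Hypotheses (Mgph : gph_measurable M) (mfb : borel_meas fb)
  (Mfb : {ae mu, forall w, M w (fb w)}).

(** For each [e i] and each [m], select from [M w] inside the ball of radius [m.+1%:R^-1] about
    [e i] where possible, and use [fb] elsewhere. A point of [M w] in that ball is within twice the
    radius of the selection. *)
Lemma castaing : exists c : nat -> T -> E,
  [/\ c 0%N = fb, forall n, borel_meas (c n), {ae mu, forall w n, M w (c n w)} &
   {ae mu, forall w x eps, M w x -> 0 < eps -> exists n, `|x - c n w| < eps}].
Proof.
pose P := g_sigma_algebraType (@rectangles _ T R E).
pose G (k : nat * nat) := [set z : T * E | M z.1 z.2 /\ `|z.2 - e k.1| < k.2.+1%:R^-1].
have mG k : <<s @rectangles _ T R E >> (G k).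
  suff : measurable (G k : set P) by [].
  apply: mset_and; first exact: Mgph.
  suff : <<s @rectangles _ T R E >> (setT `*` [set x | `|x - e k.1| < k.2.+1%:R^-1]).
    by rewrite [X in <<s _ >> X -> _](_ : _ = [set z | `|z.2 - e k.1| < k.2.+1%:R^-1]) //;
      apply/seteqP; split=> [z []|z].
  apply: sub_sigma_algebra; do 2!eexists; split; [|split; last reflexivity]; first exact: measurableT.
  apply: sub_sigma_algebra.
  rewrite (_ : [set x | _] = ball (e k.1) k.2.+1%:R^-1); first exact: ball_open.
  by apply/seteqP; split=> x; rewrite -ball_normE /= distrC.
have /choice[D /choice[f hDf]] k := measurable_selection mu e_dense (mG k).
pose s k w := if w \in D k then f k w else fb w.
pose c n := if n is n'.+1 then if unpickle n' is Some k then s k else fb else fb.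
exists c; split=> //.
- case=> // n; rewrite /c; case: unpickle => // k.
  by have [mD mf _ _] := hDf k; exact: borel_meas_if.
- apply: filterS Mfb => w Mw [|n] //=; case: unpickle => // k; rewrite /s.
  by case: ifPn => //; rewrite inE => Dw; have [_ _ /(_ w Dw)[]] := hDf k.
have N0 (n : nat) : {ae mu, forall w, if unpickle n is Some k then
    (exists x, G k (w, x)) -> D k w else True}.
  case: unpickle => [k|]; last exact: filterE.
  have [_ _ _] := hDf k; apply: negligibleS => w /=.
  by move=> /not_implyP.
have := ae_foralln N0; apply: filterS => w hw x eps Mx eps0.
have [m me] : exists m : nat, m.+1%:R^-1 < eps / 2 by apply: natinv_lt; lra.
have [|i hi] := @e_dense x m.+1%:R^-1; first by rewrite invr_gt0.
exists (pickle (i, m)).+1; rewrite /c pickleK /s.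
have := hw (pickle (i, m)); rewrite pickleK => hk.
have Dw : D (i, m) w by apply: hk; exists x.
rewrite mem_set //.
have [_ _ /(_ w Dw)[_ /= fi]  _] := hDf (i, m).
rewrite (le_lt_trans (ler_distD (e i) _ _))// (splitr eps) ltrD//; first exact: lt_trans me.
by rewrite distrC; exact: lt_trans me.
Qed.

End Castaing.

Section NormedDistance.
Context (R : realType) (E : normedModType R) (C : set E).
Hypothesis C0 : C !=set0.

Let dist := distC (@Num.Def.normr R E) C.

Lemma distE_ge0 x : 0 <= dist x.
Proof.
have [c Cc] := C0.
exact: (@distC_ge0 R E setT (@Num.Def.normr R E) I (fun _ _ _ _ _ => I) (fun x _ => normr_ge0 x) C c (subsetT C) Cc).
Qed.

Lemma distE_le x c : C c -> dist x <= `|c - x|.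
Proof.
exact: (@distC_le R E setT (@Num.Def.normr R E) I (fun _ _ _ _ _ => I) (fun x _ => normr_ge0 x) C (subsetT C)).
Qed.

Lemma distE_lt x r : dist x < r -> exists2 c, C c & `|c - x| < r.
Proof. by have [c Cc] := C0; exact: (@distC_lt R E (@Num.Def.normr R E) C c Cc). Qed.

Lemma distE_lip x y : `|dist x - dist y| <= `|x - y|.
Proof.
have [c Cc] := C0.
have lip a b : dist a - dist b <= `|a - b|.
  have := @distC_lip R E setT (@Num.Def.normr R E) I (fun _ _ _ _ _ => I) (fun x _ => normr_ge0 x)
    (fun x y _ _ => ler_normD x y) (fun a x _ => normrZ a x) C c (subsetT C) Cc b (a - b) I I.
  by rewrite addrC subrK -/dist => h; lra.
by rewrite ler_norml lip andbT lerNl opprB distrC lip.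
Qed.

End NormedDistance.

Section NormedCones.
Context (R : realType) (E : normedModType R) (C : set E) (xb : E).
Hypothesis Cxb : C xb.
Let E0 : [set: E] 0 := I.
Let EL (a : R) (x y : E) : [set: E] x -> [set: E] y -> [set: E] (a *: x + y) := fun _ _ => I.
Let En0 (x : E) : [set: E] x -> 0 <= `|x| := fun _ => normr_ge0 x.
Let EnD (x y : E) : [set: E] x -> [set: E] y -> `|x + y| <= `|x| + `|y| := fun _ _ => ler_normD x y.
Let EnZ (a : R) (x : E) : [set: E] x -> `|a *: x| = `|a| * `|x| := fun _ => normrZ a x.

Definition tangentE_mem h :=
  @tangentP_mem R E setT (@Num.Def.normr R E) E0 EL En0 EnD EnZ C xb (subsetT C) Cxb h.

Definition contingentE h :=
  @contingentP R E setT (@Num.Def.normr R E) E0 EL En0 C xb (subsetT C) Cxb h.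

Definition normalE_polar l :=
  @normal_polar R E setT (@Num.Def.normr R E) E0 EL En0 EnD EnZ C xb (subsetT C) Cxb l.

End NormedCones.

(** * Tangent directions to the set of selections *)

Section TangentSelections.
Import numFieldNormedType.Exports.
Context d (T : measurableType d) (R : realType) (E : completeNormedModType R).
Variables (mu : {finite_measure set T -> \bar R}) (e : nat -> E).
Hypothesis e_dense : forall x eps, 0 < eps -> exists n, `|x - e n| < eps.
Variables (p : R) (hp : 1 <= p).
Variables (M : T -> set E) (fb : T -> E).
Hypothesis hfb : Lp_selections mu p M fb.

Let p0 : 0 < p. Proof. exact: lt_le_trans hp. Qed.

Let X := @Lp _ _ _ mu E p.
Let nm := @Lpnorm _ _ _ mu E p.
Let S := Lp_selections mu p M.

Let SX : S `<=` X. Proof. by move=> f []. Qed.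
Let X0 : X 0. Proof. exact: Lp0. Qed.
Let XL (a : R) x y : X x -> X y -> X (a *: x + y).
Proof. exact: (Lp_linear e_dense). Qed.
Let nm0 x : X x -> 0 <= nm x. Proof. by move=> _; exact: Lpnorm_ge0. Qed.
Let nmD x y : X x -> X y -> nm (x + y) <= nm x + nm y.
Proof. exact: (Lpnorm_triangle e_dense hp). Qed.
Let nmZ (a : R) x : X x -> nm (a *: x) = `|a| * nm x. Proof. exact: Lpnorm_scale. Qed.

Let XD := subspD XL.
Let XZ := subspZ X0 XL.
Let XB := subspB X0 XL.

Definition tangentL_mem h := @tangentP_mem _ _ X nm X0 XL nm0 nmD nmZ S fb SX hfb h.

Definition normalL_polar l := @normal_polar _ _ X nm X0 XL nm0 nmD nmZ S fb SX hfb l.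

Let fast n : R := (1 / (2 ^ n.+1)%:R) `^ p^-1.

Let fast_gt0 n : 0 < fast n.
Proof. by apply: powR_gt0; rewrite divr_gt0 // ltr0n expn_gt0. Qed.

(** Tangency is used at the base point [fb] only: it provides steps tending to zero and selections
    whose distance to [fb + th *: h], divided by the step, is fast. *)
Lemma tangent_selections_contingent h : clarke_tangent X nm S fb h ->
  {ae mu, forall w, contingent [set: E] (@Num.Def.normr _ E) (M w) (fb w) (h w)}.
Proof.
move=> /tangentL_mem[Xh hl].
have /choice[cth hc] n : exists cth : (T -> E) * R, [/\ S cth.1, 0 < cth.2,
    cth.2 < n.+1%:R^-1 & nm (cth.1 - (fb + cth.2 *: h)) < fast n * cth.2].
  have f2 : 0 < fast n / 2 by rewrite divr_gt0.
  have [del del0 hd] := hl _ f2.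
  pose th := Num.min del n.+1%:R^-1 / 2.
  have m0 : 0 < Num.min del n.+1%:R^-1 by rewrite lt_min del0 invr_gt0 /=.
  have th0 : 0 < th by rewrite divr_gt0.
  have thm : th < Num.min del n.+1%:R^-1 by rewrite /th; lra.
  move: (thm); rewrite lt_min => /andP[thd thn].
  have fb0 : nm (fb - fb) < del by rewrite subrr (seminorm0 X0 nmZ).
  have hth := hd fb th hfb fb0 th0 thd.
  have [|c Sc hcn] := @distC_lt _ _ nm S fb hfb (fb + th *: h) (fast n * th).
    apply: le_lt_trans hth _; rewrite ltr_pM2r //.
    by have := fast_gt0 n; lra.
  by exists (c, th).
(* The error divided by the step: when it is small at [w], the point [(cth n).1 w] of [M w]
   witnesses the contingent condition for [h w]. *)
pose f n := (cth n).2^-1 *: ((cth n).1 - (fb + (cth n).2 *: h)).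
have Xd n : X ((cth n).1 - (fb + (cth n).2 *: h)).
  have [Sc _ _ _] := hc n.
  exact: (XB (SX Sc) (XD (SX hfb) (XZ (cth n).2 Xh))).
have Xf n : X (f n) by exact: (XZ _ (Xd n)).
have fn n : nm (f n) <= fast n.
  have [_ th0 _ hn] := hc n; rewrite /f (nmZ _ (Xd n)) ger0_norm ?invr_ge0 ?(ltW th0) //.
  by rewrite mulrC ler_pdivrMr // ltW.
have cM : {ae mu, forall w n, M w ((cth n).1 w)}.
  by apply: ae_foralln => n; have [[_ ?] _ _ _] := hc n.
move: cM hfb.2 (ae_cvg0_of_fast hp Xf fn); apply: filterS3 => w cM Mw f0.
apply/(contingentE Mw); split=> // del eta del0 eta0.
have [N hN] := f0 _ eta0.
have [m me] := natinv_lt del0.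
have [_ th0 thn _] := hc (maxn N m).
exists (cth (maxn N m)).2; split=> //.
  apply: lt_le_trans thn _; apply: le_trans (ltW me).
  by rewrite lef_pV2 ?posrE // ler_nat ltnS leq_maxr.
apply: le_lt_trans (distE_le _ (cM (maxn N m))) _.
have := hN _ (leq_maxl N m); rewrite /f /= normrZ ger0_norm ?invr_ge0 ?(ltW th0) //.
by rewrite mulrC ltr_pdivrMr.
Qed.

Variable c : nat -> T -> E.
Hypotheses (c0 : c 0%N = fb) (mc : forall n, borel_meas (c n))
  (cM : {ae mu, forall w n, M w (c n w)})
  (c_dense : {ae mu, forall w x eps, M w x -> 0 < eps -> exists n, `|x - c n w| < eps}).

(** Agrees a.e. with the distance to [M w] ([cdistE]), but is an infimum over a countable measurable
    family, hence measurable in [w]. *)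
Definition cdist w x := distC (@Num.Def.normr R E) (range (c ^~ w)) x.

Let rc0 w : range (c ^~ w) !=set0. Proof. by exists (c 0%N w); exists 0%N. Qed.

Lemma cdist_ge0 w x : 0 <= cdist w x.
Proof. exact: distE_ge0. Qed.

Lemma cdist_lip w x y : `|cdist w x - cdist w y| <= `|x - y|.
Proof. exact: distE_lip. Qed.

Lemma cdist_fb w x : cdist w x <= `|fb w - x|.
Proof. by apply: distE_le; exists 0%N => //; rewrite c0. Qed.

Lemma cdistE : {ae mu, forall w x, distC (@Num.Def.normr R E) (M w) x = cdist w x}.
Proof.
move: cM c_dense; apply: filterS2 => w Mc dc x.
have M0 : M w !=set0 by exists (c 0%N w).
apply/eqP; rewrite eq_le; apply/andP; split; apply/ler_addgt0Pr => eps eps0.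
  have [|_ [n _ <-] hn] := @distE_lt _ _ _ (rc0 w) x (cdist w x + eps).
    by rewrite ltrDl.
  by apply: le_trans (ltW hn); apply: distE_le.
have e2 : 0 < eps / 2 by rewrite divr_gt0.
have [|y My hy] := @distE_lt _ _ _ M0 x (distC (@Num.Def.normr R E) (M w) x + eps / 2).
  by rewrite ltrDl.
have [n hn] := dc y _ My e2.
have : cdist w x <= `|c n w - x| by apply: distE_le; exists n.
by have := ler_distD y (c n w) x; rewrite [`|c n w - y|]distrC; lra.
Qed.

Lemma measurable_cdist (f : T -> E) : borel_meas f -> measurable_fun setT (fun w => cdist w (f w)).
Proof.
apply: (measurable_caratheodory e_dense) => [x|w]; last first.
  by exists 1 => x y; rewrite mul1r; exact: cdist_lip.
apply: measurable_fun_lt => r.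
rewrite [X in measurable X](_ : _ = [set w | exists n, `|c n w - x| < r]).
  by apply: mset_ex => n; exact: mset_ball.
apply/seteqP; split=> w /=; first by move=> /(distE_lt (rc0 w))[_ [n _ <-]]; exists n.
by move=> [n hn]; apply: le_lt_trans hn; apply: distE_le; exists n.
Qed.

(** Taking at each [w] the first [c n w] that is nearest to [z w] up to [eta] gives a measurable
    selection that almost realizes all pointwise distances at once. *)
Lemma dist_selections_le (z : T -> E) (a : R) : X z -> 0 <= a ->
  (powint mu p (fun w => cdist w (z w)) <= (a `^ p)%:E)%E -> distC nm S z <= a.
Proof.
move=> Xz a0 za; apply/ler_addgt0Pr => eps eps0.
(* The norm of the constant 1, so that the uniform error [eta] costs [eta * m <= eps] in norm. *)
pose m := (fine (mu setT)) `^ p^-1.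
have m0 : 0 <= m by exact: powR_ge0.
pose eta := eps / (m + 1).
have eta0 : 0 < eta by rewrite divr_gt0 // ltr_wpDl.
have mz := measurable_cdist Xz.1.
have mnz := measurable_norm_fun Xz.1; have mnfb := measurable_norm_fun hfb.1.1.
have [||N hN mN] := @mset_first _ _ (fun n w => `|c n w - z w| < cdist w (z w) + eta).
- move=> n; apply: mset_lt.
    apply: (@measurable_norm_fun _ _ _ _ (fun w => c n w - z w)).
    rewrite (_ : (fun w => _) = (fun w => (-1) *: z w + c n w)).
      by apply: (borel_meas_linear e_dense) => //; exact: Xz.1.
    by apply/funext => w; rewrite scaleN1r addrC.
  by apply: measurable_funD => //; exact: measurable_cst.
- move=> w; have [|_ [n _ <-] hn] := @distE_lt _ _ _ (rc0 w) (z w) (cdist w (z w) + eta).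
    by rewrite ltrDl.
  by exists n.
pose s w := c (N w) w.
have ms : borel_meas s by exact: borel_meas_countable.
(* Integrability of [s] rests on [c 0 = fb]: the distance from [z w] is at most that to [fb w],
   which bounds [s] through [z] and [fb]. *)
have Xs : X s.
  split=> //; apply: (@le_lt_trans _ _ (powint mu p (fun w => (`|z w| + (`|z w| + (`|fb w| + eta)))%R))).
    apply: powint_le => //.
    - exact: measurable_norm_fun.
    - by do 3!apply: measurable_funD => //.
    - by move=> w; rewrite !addr_ge0 // ltW.
    - apply: filterE => w; have := hN w; have := cdist_fb w (z w).
      have := ler_normB (fb w) (z w); have := ler_normD (s w - z w) (z w).
      by rewrite subrK -/(s w); lra.
  have If : (powint mu p (fun w => `|fb w|%R) < +oo)%E by exact: hfb.1.2.
  have Iz : (powint mu p (fun w => `|z w|%R) < +oo)%E by exact: Xz.2.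
  have mc' : measurable_fun setT (fun _ : T => eta) by exact: measurable_cst.
  have m1 : measurable_fun setT (fun w => `|fb w| + eta) by exact: measurable_funD.
  have m2 : measurable_fun setT (fun w => `|z w| + (`|fb w| + eta)) by exact: measurable_funD.
  have eta0' := ltW eta0.
  have n1 w : 0 <= `|fb w| + eta by rewrite addr_ge0.
  have n2 w : 0 <= `|z w| + (`|fb w| + eta) by rewrite addr_ge0.
  have nz w : 0 <= `|z w| by [].
  have nf w : 0 <= `|fb w| by [].
  have I1 := powint_add_fin hp mnfb mc' nf (fun=> eta0') If (powint_cst mu p eta0').
  have I2 := powint_add_fin hp mnz m1 nz n1 Iz I1.
  exact: (powint_add_fin hp mnz m2 nz n2 Iz I2).
have Ss : S s.
  by split=> //; apply: filterS cM => w; exact.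
apply: le_trans (distC_le X0 XL nm0 SX Xz Ss) _.
have Xsz : X (s - z) by exact: (XB Xs Xz).
apply: (@le_trans _ _ (a + eta * m)); last first.
  rewrite lerD2l /eta mulrAC ler_pdivrMr ?ltr_wpDl // ler_pM2l //.
  by rewrite lerDl.
apply: Lpnorm_powint_le => //; first by rewrite addr_ge0 // mulr_ge0 // ltW.
apply: (@le_trans _ _ (powint mu p (fun w => (cdist w (z w) + eta)%R))).
  apply: powint_le => //.
  - exact: measurable_norm_fun Xsz.1.
  - by apply: measurable_funD.
  - by move=> w; rewrite addr_ge0 ?cdist_ge0 // ltW.
  - by apply: filterE => w; exact: ltW (hN w).
apply: Lpnorm_minkowski => //.
- by move=> w; exact: cdist_ge0.
- by move=> w; exact: ltW.
- by rewrite mulr_ge0 // ltW.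
have mp : m `^ p = fine (mu setT).
  by rewrite /m -powRrM mulVf ?gt_eqF // powRr1 // fine_ge0.
rewrite [X in (_ <= X%:E)%E](powRM p (ltW eta0) m0) mp /powint integral_cst //.
by rewrite EFinM fineK // fin_num_measure.
Qed.

(** If it failed, there would be selections [y n] tending fast to [fb] and steps [th n] tending to
    zero with quotients above [eps]. The pointwise quotients [u n] tend to zero in [Lp], and
    [dist_selections_le] gives a contradiction. *)
Lemma tangent_selections h : X h ->
  {ae mu, forall w, clarke_tangent [set: E] (@Num.Def.normr _ E) (M w) (fb w) (h w)} ->
  clarke_tangent X nm S fb h.
Proof.
move=> Xh hT; apply/tangentL_mem; split=> // eps eps0; apply: contrapT => nex.
have /choice[yth hy] n : exists yth : (T -> E) * R, [/\ S yth.1, nm (yth.1 - fb) <= fast n,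
    0 < yth.2, yth.2 < n.+1%:R^-1 & eps * yth.2 < distC nm S (yth.1 + yth.2 *: h)].
  have m0 : 0 < Num.min (fast n) n.+1%:R^-1 by rewrite lt_min fast_gt0 invr_gt0 /=.
  apply: contrapT => nyth; apply: nex; exists (Num.min (fast n) n.+1%:R^-1) => // y th Sy.
  rewrite !lt_min => /andP[yf _] th0 /andP[_ thn].
  rewrite leNgt; apply/negP => lt; apply: nyth; exists (y, th); split=> //.
  exact: ltW.
pose y n := (yth n).1; pose th n := (yth n).2.
have th0 n : 0 < th n by have [] := hy n.
have Xy n : X (y n) by have [[]] := hy n.
pose z n := y n + th n *: h.
have Xz n : X (z n) by exact: (XD (Xy n) (XZ _ Xh)).
pose u n w := (th n)^-1 * cdist w (z n w).
have u0 n w : 0 <= u n w by rewrite mulr_ge0 ?cdist_ge0 // invr_ge0 ltW.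
have mz n : measurable_fun setT (fun w => cdist w (z n w)).
  by apply: measurable_cdist; exact: (Xz n).1.
have mu_ n : measurable_fun setT (u n) by exact: measurable_funM.
have yM : {ae mu, forall w n, M w (y n w)}.
  by apply: ae_foralln => n; have [[]] := hy n.
have Xyf n : X (y n - fb) by exact: (XB (Xy n) (SX hfb)).
have yfb := ae_cvg0_of_fast hp Xyf (fun n => let: And5 _ h _ _ _ := hy n in h).
(* As [y n w] is in [M w], the distance from [y n w + th n *: h w] is at most the length of the
   step. *)
have uh : {ae mu, forall w n, u n w <= `|h w|}.
  move: yM cdistE; apply: filterS2 => w My dE n.
  rewrite /u mulrC ler_pdivrMr // -dE.
  apply: le_trans (distE_le _ (My n)) _.
  by rewrite /z /= opprD addrA subrr sub0r normrN normrZ gtr0_norm // mulrC.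
(* The base points [y n w] move, so this uses Clarke tangency of [h w] and not just contingency. *)
have uc : {ae mu, forall w, forall eta, 0 < eta -> exists N, forall n, (N <= n)%N -> u n w <= eta}.
  have [S1 S2] := (filterI yM cdistE, filterI hT yfb).
  move: S1 S2 hfb.2; apply: filterS3 => w [My dE] [hTw yfbw] Mfw eta eta0.
  have [_ /(_ _ eta0)[del del0 hd]] := (tangentE_mem Mfw (h w)).1 hTw.
  have [N hN] := yfbw _ del0; have [m me] := natinv_lt del0.
  exists (maxn N m) => n; rewrite geq_max => /andP[Nn mn].
  rewrite /u mulrC ler_pdivrMr // -dE; apply: hd => //; first exact: hN.
  have [_ _ _ thn _] := hy n; apply: lt_trans thn _; apply: le_lt_trans me.
  by rewrite lef_pV2 ?posrE // ler_nat ltnS.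
pose f_ n w := (u n w `^ p)%:E.
have mh : measurable_fun setT (fun w => `|h w|) := measurable_norm_fun Xh.1.
have mcst0 : measurable_fun setT (cst 0%E : T -> \bar R) by exact: measurable_cst.
have [|||_ _] := @dominated_convergence _ _ _ mu _ measurableT f_ (cst 0%E)
  (fun w => (`|h w| `^ p)%:E) (fun n => measurable_powEFin p (mu_ n)) mcst0.
- apply: filterS uc => w uw _; apply/cvg_EFin; first exact: nearW.
  apply/cvgrPdist_le => eta eta0; have := uw (eta `^ p^-1) (powR_gt0 _ eta0).
  move=> [N hN]; exists N => // n /= Nn.
  rewrite sub0r normrN ger0_norm ?powR_ge0 //.
  have := ge0_ler_powR (ltW p0) (u0 n w) (powR_ge0 _ _) (hN n Nn).
  by rewrite -powRrM mulVf ?gt_eqF // powRr1 // ltW.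
- apply/integrableP; split; first exact: measurable_powEFin.
  under eq_integral => w _ do rewrite gee0_abs ?lee_fin ?powR_ge0 //.
  exact: Xh.2.
- apply: filterS uh => w uw n _; rewrite /f_ gee0_abs ?lee_fin ?powR_ge0 //.
  by rewrite ge0_ler_powR ?nnegrE // ltW.
rewrite integral0 => /fine_cvgP[[N1 _ ff] /cvgrPdist_le hl].
have e2 : 0 < (eps / 2) `^ p by rewrite powR_gt0 // divr_gt0.
have [N2 _ hN] := hl _ e2.
pose n := maxn N1 N2.
have un : (powint mu p (u n) <= ((eps / 2) `^ p)%:E)%E.
  have := hN n (leq_maxr _ _); rewrite /= sub0r normrN => hle.
  rewrite -[powint _ _ _]fineK; last exact: (ff n (leq_maxl _ _)).
  by rewrite lee_fin; apply: le_trans hle; exact: ler_norm.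
have [_ _ _ _] := hy n; apply/negP; rewrite -leNgt.
apply: (@le_trans _ _ (th n * (eps / 2))).
  apply: (dist_selections_le (Xz n)); first by rewrite mulr_ge0 ?divr_ge0 // ltW.
  rewrite (_ : (fun w => _) = (fun w => th n * u n w)).
    rewrite powint_scale // ?(ltW (th0 n)) // powRM ?(ltW (th0 n)) ?divr_ge0 ?(ltW eps0) //.
    by rewrite EFinM lee_wpmul2l // lee_fin powR_ge0.
  by apply/funext => w; rewrite /u mulVKf ?gt_eqF.
by rewrite mulrC ler_pM2r // ler_pdivrMr // ler_peMr // ?(ltW eps0) // ler1n.
Qed.

End TangentSelections.

(** * Normal cones *)

Section NormalCones.
Import numFieldNormedType.Exports.
Context d (T : measurableType d) (R : realType) (E : completeNormedModType R).
Variables (mu : {finite_measure set T -> \bar R}) (e : nat -> E).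
Hypothesis e_dense : forall x eps, 0 < eps -> exists n, `|x - e n| < eps.
Variables (p : R) (hp : 1 <= p) (M : T -> set E) (fb : T -> E).
Hypotheses (Mgph : gph_measurable M) (hfb : Lp_selections mu p M fb).
Hypothesis hreg :
  {ae mu, forall w, regular_at [set: E] (@Num.Def.normr _ E) (M w) (fb w)}.
Variable g : T -> E -> R.
Hypothesis hg : Lq_wstar mu p g.

Let NL := clarke_normal (Lp mu p) (Lpnorm mu p) (Lp_selections mu p M) fb.
Let NE w := clarke_normal [set: E] (@Num.Def.normr _ E) (M w) (fb w).

Lemma Rintegral_ae_le0 (u : T -> R) : measurable_fun setT u ->
  {ae mu, forall w, u w <= 0} -> Rintegral mu setT u <= 0.
Proof.
move=> mu' u0; rewrite /Rintegral.
(* [u] is replaced by an a.e. equal function whose sign is known everywhere. *)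
have mv : measurable_fun setT (fun w => Num.max (- u w) 0).
  by apply: measurable_maxr; [exact: measurableT_comp|exact: measurable_cst].
rewrite (@ae_eq_integral _ _ _ mu setT (fun w => (- (Num.max (- u w) 0)%:E)%E)) //.
- rewrite integral_ge0N; last by move=> w _; rewrite lee_fin le_max lexx orbT.
  rewrite fineN oppr_le0; apply/fine_ge0/integral_ge0 => w _.
  by rewrite lee_fin le_max lexx orbT.
- exact/measurable_EFinP.
- by apply/measurable_EFinP; exact: measurableT_comp.
- apply: filterS u0 => w uw _ /=; congr (_%:E).
  by rewrite max_l ?opprK // oppr_ge0.
Qed.

Lemma normal_of_pointwise : {ae mu, forall w, NE w (g w)} -> NL (pairing mu g).
Proof.
move=> hN; apply: (normalL_polar e_dense hp hfb); first exact: (pairing_dual e_dense hp hg).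
move=> h hT; have Xh : Lp mu p h by case: hT.
apply: Rintegral_ae_le0; first exact: (measurable_pairing e_dense hg Xh.1).
have hc := tangent_selections_contingent e_dense hp hfb hT.
move: hN hreg hc; apply: filterS3 => w Ng reg.
by rewrite -reg => -[_]; apply.
Qed.

Lemma pointwise_of_normal : NL (pairing mu g) -> {ae mu, forall w, NE w (g w)}.
Proof.
move=> hN; have [gd [gm _]] := hg.
have [c [c0 mc cM c_dense]] := castaing e_dense Mgph hfb.1.1 hfb.2.
pose D := cdist c.
have Dlip w x y : `|D w x - D w y| <= `|x - y| by exact: cdist_lip.
have dE := cdistE cM c_dense.
pose th_ok (n : nat) (q : rat) := 0 < ratr q :> R /\ ratr q < n.+1%:R^-1 :> R.
(* The contingent cone with rational steps and with [n] governing both the step and the tolerance: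
   countably many Caratheodory conditions. *)
pose Gc := [set z : T * E | forall n : nat, exists q : rat,
  th_ok n q /\ D z.1 (fb z.1 + ratr q *: z.2) < n.+1%:R^-1 * ratr q].
pose G := [set z : T * E | Gc z /\ - g z.1 z.2 < 0].
pose P := g_sigma_algebraType (@rectangles _ T R E).
have mG : <<s @rectangles _ T R E >> G.
  suff : measurable (G : set P) by [].
  apply: mset_and; last first.
    apply: (@caratheodory_graph _ _ _ _ _ e_dense (fun w x => - g w x) 0).
      by move=> x; exact: measurableT_comp.
    move=> w; exists (fine (dual_norm (g w))) => x y.
    by rewrite -opprD normrN; exact: dual_lipschitz.
  apply: mset_all => n; apply: mset_ex => q; apply: mset_and; first exact: mset_const.
  apply: (@caratheodory_graph _ _ _ _ _ e_dense (fun w x => D w (fb w + ratr q *: x))).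
    move=> x; apply: (measurable_cdist e_dense mc).
    rewrite (_ : (fun w => _) = (fun w => 1 *: fb w + (fun=> ratr q *: x) w)).
      by apply: (borel_meas_linear e_dense); [exact: hfb.1.1|exact: borel_meas_cst].
    by apply/funext => w; rewrite scale1r.
  move=> w; exists `|ratr q| => x y; apply: le_trans (Dlip _ _ _) _.
  by rewrite opprD addrACA subrr add0r -scalerBr normrZ.
have GcE w h : (forall x, distC (@Num.Def.normr R E) (M w) x = D w x) -> M w (fb w) ->
    Gc (w, h) <-> contingent [set: E] (@Num.Def.normr _ E) (M w) (fb w) h.
  move=> Dw Mw; rewrite (contingentE Mw); split=> [hG|[_ hc] n].
    split=> // del eta del0 eta0.
    have [n] := @natinv_lt R (Num.min del eta) ltac:(by rewrite lt_min del0).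
    rewrite lt_min => /andP[ndel neta].
    have [q [[q0 qn] hq]] := hG n; exists (ratr q); split=> //; first exact: lt_trans ndel.
    by rewrite Dw; apply: lt_trans hq _; rewrite ltr_pM2r.
  have n0 : 0 < n.+1%:R^-1 :> R by rewrite invr_gt0.
  have n1 : n.+1%:R^-1 <= 1 :> R by rewrite invf_le1 // ler1n.
  have [th [th0 thn hth]] := hc _ _ n0 n0; rewrite Dw in hth.
  (* The slack in the strict inequality at [th]. Passing to a rational [q] just below [th] changes
     the two sides by at most [(th - q) * (|h| + 1)], which [s] keeps below the slack. *)
  pose gam := n.+1%:R^-1 * th - D w (fb w + th *: h).
  have gam0 : 0 < gam by rewrite subr_gt0.
  have h1 : 0 < `|h| + 1 by rewrite ltr_pwDr.
  pose s := Num.min th (gam / (`|h| + 1)).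
  have s0 : 0 < s by rewrite lt_min th0 divr_gt0.
  have sth : s <= th by rewrite ge_min lexx.
  have sg : s * (`|h| + 1) <= gam by rewrite -ler_pdivlMr // ge_min lexx orbT.
  have [|q] := @rat_in_itvoo R (th - s) th; first by rewrite ltrBlDr ltrDl.
  rewrite in_itv /= => /andP[q1 q2].
  have q0 : 0 < ratr q :> R by apply: le_lt_trans q1; rewrite subr_ge0.
  exists q; split; first by split=> //; exact: lt_trans thn.
  have hN' : `|(fb w + ratr q *: h) - (fb w + th *: h)| = (th - ratr q) * `|h|.
    rewrite opprD addrACA subrr add0r -scalerBl normrZ distrC ger0_norm //.
    by rewrite subr_ge0 ltW.
  have hD := le_trans (ler_norm _) (Dlip w (fb w + ratr q *: h) (fb w + th *: h)).
  rewrite hN' in hD.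
  have hD2 : (th - ratr q) * `|h| <= s * `|h|.
    by rewrite ler_wpM2r // lerBlDr -lerBlDl ltW.
  have hq : n.+1%:R^-1 * (th - ratr q) <= th - ratr q.
    by rewrite ler_piMl // subr_ge0 ltW.
  move: sg hq hD hD2; rewrite /gam !mulrDr mulr1 mulrN /=; set a := n.+1%:R^-1.
  by move=> sg hq hD hD2; lra.
have [D' [f0 [mD' mf0 f0G projD']]] := measurable_selection mu e_dense mG.
(* Truncation puts the selected directions in [Lp], the measure being finite; the value 0 taken
   elsewhere is always tangent. *)
pose A (k : nat) := D' `&` [set w | `|f0 w| < k%:R].
have mA k : measurable (A k).
  apply: measurableI => //; apply: mset_lt; last exact: measurable_cst.
  exact: measurable_norm_fun.
pose hk k w := if w \in A k then f0 w else 0.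
have Lhk k : Lp mu p (hk k).
  have mhk : borel_meas (hk k) by apply: borel_meas_if => //; exact: borel_meas_cst.
  split=> //; apply: (@le_lt_trans _ _ (powint mu p (fun _ => k%:R))).
    apply: powint_le => //; first exact: measurable_norm_fun.
    apply: filterE => w; rewrite /hk; case: ifPn; rewrite ?inE ?normr0 //.
    by move=> [_ /ltW].
  exact: powint_cst.
have Thk k : {ae mu, forall w, clarke_tangent [set: E] (@Num.Def.normr _ E) (M w) (fb w) (hk k w)}.
  move: hreg dE hfb.2; apply: filterS3 => w reg Dw Mw; rewrite /hk; case: ifPn.
    by rewrite inE => -[D'w _]; rewrite reg; apply/(GcE _ _ Dw Mw); have [] := f0G w D'w.
  by move=> _; split=> // l [ld _]; rewrite (dual_elt0 ld).
(* [hk k] is tangent to the set of selections, so its pairing with [g] is at most 0; but the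
   integrand is nonnegative, and positive on [A k]. *)
have A0 k : {ae mu, forall w, ~ A k w}.
  have hT := tangent_selections e_dense hp hfb c0 mc cM c_dense (Lhk k) (Thk k).
  have ple : pairing mu g (hk k) <= 0 by have [_] := hT; apply.
  have ge0 w : 0 <= g w (hk k w).
    rewrite /hk; case: ifPn; last by rewrite (dual_elt0 (gd w)).
    by rewrite inE => -[D'w _]; have [_ /=] := f0G w D'w; rewrite oppr_lt0 => /ltW.
  have ig := integrable_pairing e_dense hp hg (Lhk k).
  have I0 : (\int[mu]_w `|(g w (hk k w))%:E| = 0)%E.
    under eq_integral => w _ do rewrite gee0_abs ?lee_fin //.
    have fin := integrable_fin_num measurableT ig.
    apply/eqP; rewrite eq_le integral_ge0 ?andbT; last by move=> w _; rewrite lee_fin.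
    by rewrite -[leLHS]fineK // lee_fin.
  have mg : measurable_fun setT (fun w => (g w (hk k w))%:E).
    by apply/measurable_EFinP; exact: (measurable_pairing e_dense hg (Lhk k).1).
  have := (ae_eq_integral_abs mu measurableT mg).1 I0.
  apply: filterS => w /(_ I) /= [gw0] Aw.
  move: gw0; rewrite /hk mem_set // => gw0.
  by have [_ /=] := f0G w Aw.1; rewrite gw0 oppr0 ltxx.
have D'0 : {ae mu, forall w, ~ D' w}.
  have := ae_foralln A0; apply: filterS => w hw D'w.
  by apply: (hw (Num.truncn `|f0 w|).+1); split=> //=; exact: truncnS_gt.
have projG : {ae mu, forall w, (exists x, G (w, x)) -> D' w}.
  by move: projD'; apply: negligibleS => w /= /not_implyP.
have [S1 S2] := (filterI projG D'0, filterI hreg dE).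
move: S1 S2 hfb.2; apply: filterS3 => w [pG nD'] [reg Dw] Mw.
apply: (normalE_polar Mw) => // h; rewrite reg => hc.
rewrite leNgt; apply/negP => gh; apply: nD'; apply: pG; exists h; split.
  exact/(GcE _ _ Dw Mw).
by rewrite /= oppr_lt0.
Qed.

End NormalCones.

Theorem theorem4 (R : realType) (d : measure_display) (T : measurableType d)
  (mu : {finite_measure set T -> \bar R}) (E : completeNormedModType R)
  (Esep : exists D : set E, countable D /\ closure D = [set: E])
  (p : R) (hp : 1 <= p)
  (M : T -> set E) (Mclosed : forall w, closed (M w))
  (Mgph : gph_measurable M)
  (fb : T -> E) (hfb : Lp_selections mu p M fb)
  (hreg : {ae mu, forall w, regular_at [set: E] (@Num.Def.normr _ E) (M w) (fb w)})
  (g : T -> E -> R) (hg : Lq_wstar mu p g) :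
  clarke_normal (Lp mu p) (Lpnorm mu p) (Lp_selections mu p M) fb (pairing mu g)
  <-> {ae mu, forall w, clarke_normal [set: E] (@Num.Def.normr _ E) (M w) (fb w) (g w)}.
Proof.
have [e e_dense] := dense_sequence Esep; split.
- exact: (pointwise_of_normal e_dense hp Mgph hfb hreg hg).
- exact: (normal_of_pointwise e_dense hp hfb hreg hg).
Qed.
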